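(* Let $\mathbb{F}$ be a field of characteristic zero and let $\varepsilon > 0$ be a fixed constant. Assume that any border formula which computes the $n\times n$ determinant $\det_n(X)$ has size $n^{\omega(1)}$. Then there is an explicit sequence of polynomial maps $\mathcal{G} = (\mathcal{G}_n : \mathbb{F}^{n - n^{1-\varepsilon}} \to \mathbb{F}^n)_{n\in\mathbb{N}}$ such that $\mathcal{G}$ is a $\mathsf{VNC}^0$-computable hitting set generator for $\mathsf{VF}$.
   Context: An arithmetic circuit over a field is a directed acyclic graph whose in-degree-zero vertices (input gates) are labeled by variables or field constants and whose other vertices (internal gates) are labeled $+$ or $\times$; its size is the number of internal gates. An arithmetic formula is an arithmetic circuit whose underlying graph is a tree. A border formula for a polynomial $f \in \mathbb{F}[\vec x]$ is a formula over $\mathbb{F}(\epsilon)$ ($\epsilon$ an indeterminate) that computes a polynomial of the form $f(\vec x) + \epsilon\, g(\vec x,\epsilon)$ with $g \in \mathbb{F}[\vec x,\epsilon]$. A $p$-family is a sequence of polynomials $(f_n)_n$ over $\mathbb{F}$ with $\deg f_n$ polynomially bounded in $n$. $\mathsf{VF}$ is the class of $p$-families with $f_n$ computable by formulas of size $n^{O(1)}$; $\mathsf{VNC}^0$ is the class of $p$-families with $f_n$ computable by circuits of size $O(1)$. For a sequence of polynomial maps $\mathcal{G} = (\mathcal{G}_n : \mathbb{F}^{\ell(n)} \to \mathbb{F}^n)_{n}$ with $\mathcal{G}_n = (g_{n,1},\ldots,g_{n,n})$, and classes $\mathscr{C},\mathscr{D}$ of $p$-families, $\mathcal{G}$ is a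 $\mathscr{D}$-computable hitting set generator for $\mathscr{C}$ if (1) every $p$-family of the form $(g_{n,i_n})_{n}$ lies in $\mathscr{D}$, and (2) for every $p$-family $(f_n)_n \in \mathscr{C}$ and all sufficiently large $n$, $f_n \circ \mathcal{G}_{m(n)} = 0$ if and only if $f_n = 0$, where $m(n)$ is the number of variables of $f_n$.
   Formalization: The hitting condition is required only for families whose index n is polynomially bounded in the number of variables m(n); without this it fails, e.g. for the constant family x_1 - c, where G_1 = (c) has seed length 0. *)

(* Defs.v *)
From mathcomp Require Import all_boot all_order all_algebra.
From mathcomp Require Import mpoly reals.
(* Not imported: its notations clash with those of [mpoly]. *)
From mathcomp Require exp.

Set Implicit Arguments.
Unset Strict Implicit.
Unset Printing Implicit Defensive.

Import GRing.Theory.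
Local Open Scope ring_scope.

(* A circuit is a DAG given in topological order: the operands of a gate are
   positions of earlier gates, and the last gate is the output.  Gates have
   fan-in two. *)
Inductive gate (T : Type) (m : nat) : Type :=
| GVar of 'I_m
| GConst of T
| GAdd of nat & nat
| GMul of nat & nat.

Definition circuit (T : Type) (m : nat) : Type := seq (gate T m).

Definition gate_internal T m (g : gate T m) : bool :=
  match g with GVar _ | GConst _ => false | GAdd _ _ | GMul _ _ => true end.

Definition circuit_size T m (C : circuit T m) : nat := count (@gate_internal T m) C.

Definition gate_wf T m (k : nat) (g : gate T m) : bool :=
  match g with
  | GVar _ | GConst _ => true
  | GAdd i j | GMul i j => (i < k) && (j < k)
  end%N.

Fixpoint gates_wf T m (k : nat) (C : circuit T m) : bool :=
  if C is g :: C' then gate_wf k g && gates_wf k.+1 C' else true.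

Definition circuit_wf T m (C : circuit T m) : bool :=
  (0 < size C)%N && gates_wf 0 C.

Definition gate_eval (K : fieldType) m (vs : seq {mpoly K[m]}) (g : gate K m) :
    {mpoly K[m]} :=
  match g with
  | GVar i => 'X_i
  | GConst c => c%:MP
  | GAdd i j => vs`_i + vs`_j
  | GMul i j => vs`_i * vs`_j
  end.

Definition circuit_eval (K : fieldType) m (C : circuit K m) : {mpoly K[m]} :=
  last 0 (foldl (fun vs g => rcons vs (gate_eval vs g)) [::] C).

Definition circuit_computes (K : fieldType) m (C : circuit K m)
    (p : {mpoly K[m]}) : Prop :=
  circuit_wf C /\ circuit_eval C = p.

Inductive formula (T : Type) (m : nat) : Type :=
| FVar of 'I_m
| FConst of T
| FAdd of formula T m & formula T m
| FMul of formula T m & formula T m.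

Fixpoint formula_size T m (phi : formula T m) : nat :=
  match phi with
  | FVar _ | FConst _ => 0
  | FAdd a b | FMul a b => (formula_size a + formula_size b).+1
  end%N.

Fixpoint formula_eval (K : fieldType) m (phi : formula K m) : {mpoly K[m]} :=
  match phi with
  | FVar i => 'X_i
  | FConst c => c%:MP
  | FAdd a b => formula_eval a + formula_eval b
  | FMul a b => formula_eval a * formula_eval b
  end.

(* [{fraction {poly F}}] is F(eps); the indeterminate eps is ['X : {poly F}].
   F[x, eps] is represented as F[eps][x]. *)
Definition border_formula (F : fieldType) m
    (phi : formula {fraction {poly F}} m) (f : {mpoly F[m]}) : Prop :=
  exists g : {mpoly {poly F}[m]},
    formula_eval phi =
      map_mpoly (@tofrac {poly F})
        (map_mpoly (@polyC F) f + ('X : {poly F}) *: g).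

Definition generic_matrix (F : fieldType) n : 'M[{mpoly F[n * n]}]_n :=
  \matrix_(i, j) 'X_(mxvec_index i j).

Definition det_poly (F : fieldType) n : {mpoly F[n * n]} :=
  \det (generic_matrix F n).

Definition poly_bounded (u : nat -> nat) : Prop :=
  exists c : nat, forall n, (u n <= n ^ c + c)%N.

Record family (F : fieldType) : Type := Family {
  nvars : nat -> nat;
  fpoly : forall n, {mpoly F[nvars n]}
}.

(* [msize p] is the total degree plus one, and [msize 0 = 0]. *)
Definition p_family (F : fieldType) (f : family F) : Prop :=
  poly_bounded (fun n => (msize (fpoly f n)).-1).

Definition VF (F : fieldType) (f : family F) : Prop :=
  p_family f /\
  exists s : nat -> nat, poly_bounded s /\
    forall n, exists phi : formula F (nvars f n),
      formula_eval phi = fpoly f n /\ (formula_size phi <= s n)%N.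

Definition VNC0 (F : fieldType) (f : family F) : Prop :=
  p_family f /\
  exists c : nat,
    forall n, exists C : circuit F (nvars f n),
      circuit_computes C (fpoly f n) /\ (circuit_size C <= c)%N.

(* [G n] is the list of coordinates of a polynomial map F^(l n) -> F^n. *)
Definition polymaps (F : fieldType) (l : nat -> nat) : Type :=
  forall n, n.-tuple {mpoly F[l n]}.

(* The term at n = 0 of a coordinate family is the default 0, since G_0 has no
   coordinates. *)
Definition coord_family (F : fieldType) l (G : polymaps F l) (i : nat -> nat) :
    family F :=
  @Family F l (fun n => (G n)`_(i n)).

(* The families tested in the second condition are those whose index n is
   polynomially bounded in the number of variables.  Without this no generator
   with l(k) < k for some k hits a class containing VF: a nonzero annihilator
   of the coordinates of G_k, repeated for every n, is a family with a constant
   number of variables on which the condition fails. *)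
Definition hitting_set_generator (F : fieldType) (D C : family F -> Prop)
    l (G : polymaps F l) : Prop :=
  (forall i : nat -> nat, (forall n, (0 < n)%N -> (i n < n)%N) ->
     D (coord_family G i)) /\
  (forall f : family F, C f ->
     (exists c : nat, forall n, (n <= nvars f n ^ c + c)%N) ->
     exists N : nat, forall n, (N <= n)%N ->
       (comp_mpoly (G (nvars f n)) (fpoly f n) = 0 <-> fpoly f n = 0)).

(* Cobham's function algebra, on binary strings: the polynomial-time computable
   functions.  The last rule is bounded recursion on notation. *)
Inductive polytime : forall k, (k.-tuple bitseq -> bitseq) -> Prop :=
| pt_nil k : polytime (fun _ : k.-tuple bitseq => [::])
| pt_cons (b : bool) : polytime (fun v : 1.-tuple bitseq => b :: thead v)
| pt_proj k (i : 'I_k) : polytime (fun v : k.-tuple bitseq => tnth v i)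
| pt_smash :
    polytime (fun v : 2.-tuple bitseq =>
      nseq (size (tnth v ord0) * size (tnth v ord_max)) true)
| pt_comp k l (f : k.-tuple bitseq -> bitseq)
    (g : 'I_k -> l.-tuple bitseq -> bitseq) :
    polytime f -> (forall i, polytime (g i)) ->
    polytime (fun v : l.-tuple bitseq => f [tuple g i v | i < k])
| pt_rec k (g : k.-tuple bitseq -> bitseq)
    (h : bool -> k.+2.-tuple bitseq -> bitseq)
    (b f : k.+1.-tuple bitseq -> bitseq) :
    polytime g -> (forall c, polytime (h c)) -> polytime b ->
    (forall v : k.-tuple bitseq, f [tuple of [::] :: v] = g v) ->
    (forall (c : bool) (w : bitseq) (v : k.-tuple bitseq),
       f [tuple of (c :: w) :: v] =
         h c [tuple of w :: f [tuple of w :: v] :: v]) ->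
    (forall v, (size (f v) <= size (b v))%N) ->
    polytime f.

Definition unary (n : nat) : bitseq := nseq n true.

Definition gate_code m (g : gate rat m) : seq nat :=
  match g with
  | GVar i => [:: 0; nat_of_ord i]
  | GConst c => [:: 1; nat_of_bool (numq c < 0)%R; absz (numq c); absz (denq c)]
  | GAdd i j => [:: 2; i; j]
  | GMul i j => [:: 3; i; j]
  end%N.

(* Each number is written in unary and followed by a terminator. *)
Definition circuit_code m (C : circuit rat m) : bitseq :=
  flatten [seq rcons (unary k) false | k <- flatten [seq gate_code g | g <- C]].

Definition gate_map (T U : Type) (h : T -> U) m (g : gate T m) : gate U m :=
  match g with
  | GVar i => GVar U i
  | GConst c => GConst m (h c)
  | GAdd i j => GAdd U m i j
  | GMul i j => GMul U m i j
  end.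

(* Uniformity: a polynomial-time algorithm that, given n and i in unary, writes
   down a circuit with rational constants for the i-th coordinate of G_n. *)
Definition explicit (F : fieldType) l (G : polymaps F l) : Prop :=
  exists2 e : 2.-tuple bitseq -> bitseq, polytime e &
    forall (n : nat) (i : 'I_n), exists C : circuit rat (l n),
      e [tuple unary n; unary i] = circuit_code C /\
      circuit_computes (map (gate_map (@ratr F) (m := l n)) C) (tnth (G n) i).

(* The integer part of n - n^(1 - eps). *)
Definition seed_length (R : realType) (eps : R) (n : nat) : nat :=
  Num.truncn (n%:R - exp.powR (n%:R) (1 - eps)).

(* Main.v *)
(* The generator outputs additive shares of the entries of an n x n matrix of rank at
   most r: each entry sum_(k < r) y_(k,p) z_(k,q) is spread over r outputs by telescoping
   masks rho, so every output has constant size, while the seed saves n^2 - 2nr = M^(1 - O(1/a))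
   coordinates when n = r^a.  Fixing all shares but one, a nonzero f vanishing on the
   generator becomes a nonzero f' on n x n matrices, with a formula of comparable size, that
   vanishes on all matrices of rank at most r.

   For generic A, B and the torus T = diag(eps^(b^i)), X = L D U gives
   f'(A T X T B) = f'(A L' T D T U' B) with L', U' = 1 + O(eps).  Expanding f'(A diag(y) B)
   in monomials of y, the unique monomial y^mu of least weight dominates, so up to a scalar
   and a power of eps the limit is h(X) = prod_i D_i^(mu_i), where D_i is the quotient of
   consecutive leading minors.  By symmetry mu is nonincreasing, and vanishing in rank r
   forces mu_0, ..., mu_r > 0.

   Evaluating h at the identity plus t times the leading j x j block of an (r+1) x (r+1)
   matrix x gives g_j with g_(j+1) / g_j = D_j^(mu_j), hence det (1 + t x) is the
   exponential of sum_j (log g_(j+1) - log g_j) / mu_j, and det x is its coefficient of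
   t^(r+1), recovered by interpolation in t.  So det_(r+1) has border formulas of size
   polynomial in r, contradicting the hypothesis. *)

Require Import Defs.
From mathcomp Require Import all_boot all_order all_algebra.
From mathcomp Require Import fingroup perm mpoly reals.
From mathcomp Require Import zify ring lra.
From mathcomp Require exp.
From Stdlib Require Import FunctionalExtensionality.

Set Implicit Arguments.
Unset Strict Implicit.
Unset Printing Implicit Defensive.

Import GRing.Theory.
Local Open Scope ring_scope.

(** * Nonvanishing points of polynomials *)

Lemma rmorph_mmap n (R : nzRingType) (S T : comNzRingType) (f : {rmorphism R -> S})
    (h : 'I_n -> S) (g : {rmorphism S -> T}) (p : {mpoly R[n]}) :
  g (mmap f h p) = mmap (g \o f) (g \o h) p.
Proof.
rewrite /mmap rmorph_sum /=; apply: eq_bigr => m _.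
rewrite rmorphM /= /mmap1 rmorph_prod; congr (_ * _).
by apply: eq_bigr => i _; rewrite rmorphXn.
Qed.

Lemma eq_mmap n (R S : nzRingType) (f f' : R -> S) (h h' : 'I_n -> S)
    (p : {mpoly R[n]}) :
  f =1 f' -> h =1 h' -> mmap f h p = mmap f' h' p.
Proof.
by move=> ef eh; apply: eq_bigr => m _; rewrite ef; congr (_ * _); apply: mmap1_eq.
Qed.

(** Uniqueness of base-[b] digits: reduction modulo [b] isolates the lowest digit, and induction
    treats the quotient. *)
Lemma sum_base_inj b n (u v : 'I_n -> nat) :
  (forall i, u i < b)%N -> (forall i, v i < b)%N ->
  (\sum_(i < n) u i * b ^ i = \sum_(i < n) v i * b ^ i)%N -> u =1 v.
Proof.
elim: n u v => [|n IHn] u v ub vb; first by move=> _ [].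
rewrite !big_ord_recl /= !expn0 !muln1.
have E w : (\sum_(i < n) w (lift ord0 i) * b ^ bump 0 i =
            (\sum_(i < n) w (lift ord0 i) * b ^ i) * b)%N.
  by rewrite big_distrl /=; apply: eq_bigr => i _; rewrite /bump /= expnSr mulnA.
rewrite !E => e.
have b0 : (0 < b)%N by apply: leq_ltn_trans (ub ord0).
have e0 : u ord0 = v ord0.
  by have /(congr1 (modn^~ b)) := e; rewrite /= ![(_ + _ * b)%N]addnC !modnMDl !modn_small.
move: e; rewrite e0 => /addnI/eqP; rewrite eqn_pmul2r // => /eqP/IHn es i.
by case: (unliftP ord0 i) => [j ->|->] //; apply: es.
Qed.

(** The exponent of [t] in the monomial [m] under [x_i := t ^ (b ^ i)]. The exponents of [m] are its
    base-[b] digits as soon as they are below [b]. *)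
Definition mweight_base b n (m : 'X_{1..n}) : nat := (\sum_(i < n) m i * b ^ i)%N.

Lemma mnm_le_mdeg n (m : 'X_{1..n}) i : (m i <= mdeg m)%N.
Proof. by rewrite mdegE (bigD1 i) //= leq_addr. Qed.

Lemma mweight_base_inj n (R : nzRingType) (p : {mpoly R[n]}) b :
  (msize p <= b)%N -> {in msupp p &, injective (@mweight_base b n)}.
Proof.
move=> pb m1 m2 s1 s2 e; apply/mnmP; apply: sum_base_inj e => i;
  by apply: leq_ltn_trans (mnm_le_mdeg _ _) _; apply: leq_trans pb; apply: msize_mdeg_lt.
Qed.

Section InfiniteField.
Variable F : fieldType.
Hypothesis charF0 : [pchar F] =i pred0.

Lemma natr_eq0_char0 n : ((n%:R : F) == 0) = (n == 0)%N.
Proof. exact: ((pcharf0P F).1 charF0). Qed.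

Lemma natr_inj_char0 : injective (fun n : nat => n%:R : F).
Proof.
have H m n : (m <= n)%N -> m%:R = n%:R :> F -> m = n.
  move=> mn /eqP; rewrite eq_sym -subr_eq0 -natrB // natr_eq0_char0 subn_eq0 => nm.
  by apply/eqP; rewrite eqn_leq mn.
move=> m n e; case: (leqP m n) => [/H|/ltnW/H]; first exact.
by move=> h; apply/esym/h.
Qed.

(** A nonzero polynomial has fewer roots than its size, and in characteristic zero the integers
    below that size are distinct points. *)
Lemma poly_neq0_point (p : {poly F}) : p != 0 -> exists a, p.[a] != 0.
Proof.
move=> p0; pose s := [seq i%:R : F | i <- iota 0 (size p)].
have us : uniq s by rewrite map_inj_uniq ?iota_uniq //; exact: natr_inj_char0.
have /allPn[a _ ra] : ~~ all (root p) s.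
  by apply/negP => /(max_poly_roots p0)/(_ us); rewrite size_map size_iota ltnn.
by exists a.
Qed.

Lemma poly_eq0_points (p : {poly F}) : (forall a, p.[a] = 0) -> p = 0.
Proof.
by move=> h; apply/eqP/negP => /negP/poly_neq0_point[a]; rewrite h eqxx.
Qed.

(* Kronecker substitution x_i := t ^ (b ^ i) reduces to one variable. *)
Lemma mpoly_neq0_point n (p : {mpoly F[n]}) : p != 0 -> exists v, p.@[v] != 0.
Proof.
move=> p0; pose b := msize p.
pose q : {poly F} := mmap polyC (fun i : 'I_n => 'X^(b ^ i)) p.
have qE : q = \sum_(m <- msupp p) p@_m *: 'X^(mweight_base b m).
  rewrite /q /mmap; apply: eq_bigr => m _; rewrite mul_polyC; congr (_ *: _).
  rewrite /mmap1 /mweight_base -prodrXr; apply: eq_bigr => i _.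
  by rewrite -exprM mulnC.
have q0 : q != 0.
  apply/eqP => /(congr1 (fun r : {poly F} => r`_(mweight_base b (mlead p)))).
  have ls := mlead_supp p0.
  rewrite qE coef_sum (bigD1_seq _ ls (msupp_uniq p)) /= coefZ coefXn eqxx mulr1.
  rewrite big_seq_cond big1 => [|m /andP[ms nm]].
    by rewrite addr0 coef0 => /eqP; rewrite mleadc_eq0 (negPf p0).
  rewrite coefZ coefXn; case: eqP => [e|_]; last by rewrite mulr0.
  by rewrite (mweight_base_inj (leqnn _) ls ms e) eqxx in nm.
have [a] := poly_neq0_point q0; rewrite -horner_evalE rmorph_mmap => h.
exists (fun i => a ^+ (b ^ i)); apply: contraNneq h => <-; apply/eqP.
by apply: eq_mmap => i /=; rewrite /horner_eval ?hornerC ?hornerXn.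
Qed.

Lemma mpoly_eq0_points n (p : {mpoly F[n]}) : (forall v, p.@[v] = 0) -> p = 0.
Proof.
by move=> h; apply/eqP/negP => /negP/mpoly_neq0_point[v]; rewrite h eqxx.
Qed.

End InfiniteField.

(** * Formulas and border formulas *)

Lemma mmap_map_mpoly n (R : nzRingType) (S T : comNzRingType) (f : {rmorphism R -> S})
    (g : {rmorphism S -> T}) (h : 'I_n -> T) (p : {mpoly R[n]}) :
  mmap g h (map_mpoly f p) = mmap (g \o f) h p.
Proof.
rewrite /map_mpoly (rmorph_mmap _ _ (mmap g h : {rmorphism _ -> _})).
by apply: eq_mmap => i /=; [rewrite mmapC | rewrite mmapX mmap1U].
Qed.

Lemma map_mpoly_mmap n m (R S : comNzRingType) (f : {rmorphism R -> S})
    (q : 'I_n -> {mpoly R[m]}) (p : {mpoly R[n]}) :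
  map_mpoly f (mmap (@mpolyC m R) q p) =
  mmap (@mpolyC m S) (map_mpoly f \o q) (map_mpoly f p).
Proof.
rewrite (rmorph_mmap _ _ (map_mpoly f : {rmorphism _ -> _})) mmap_map_mpoly.
by apply: eq_mmap => i //=; rewrite map_mpolyC.
Qed.

Lemma msize_subset n (R S : nzRingType) (p : {mpoly R[n]}) (q : {mpoly S[n]}) :
  {subset msupp q <= msupp p} -> (msize q <= msize p)%N.
Proof.
move=> h; rewrite [msize q]mmeasureE; elim: (msupp q) h => [|m s IHs] h.
  by rewrite big_nil.
rewrite big_cons geq_max IHs => [|x xs]; last by apply: h; rewrite inE xs orbT.
by rewrite andbT; apply: msize_mdeg_lt; apply: h; rewrite inE eqxx.
Qed.

Section FormulaSubst.
Variables (T U : Type) (m m' : nat).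

Fixpoint formula_subst (s : 'I_m -> formula T m') (phi : formula T m) : formula T m' :=
  match phi with
  | FVar i => s i
  | FConst c => FConst m' c
  | FAdd a b => FAdd (formula_subst s a) (formula_subst s b)
  | FMul a b => FMul (formula_subst s a) (formula_subst s b)
  end.

Fixpoint formula_map (h : T -> U) (phi : formula T m) : formula U m :=
  match phi with
  | FVar i => FVar U i
  | FConst c => FConst m (h c)
  | FAdd a b => FAdd (formula_map h a) (formula_map h b)
  | FMul a b => FMul (formula_map h a) (formula_map h b)
  end.

Lemma size_formula_map h phi : formula_size (formula_map h phi) = formula_size phi.
Proof. by elim: phi => //= a -> b ->. Qed.

(** A binary tree with [s] gates has [s + 1] leaves, each of which receives a formula of size at
    most [k]. *)
Lemma size_formula_subst s phi k : (forall i, formula_size (s i) <= k)%N ->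
  (formula_size (formula_subst s phi) <= formula_size phi + (formula_size phi).+1 * k)%N.
Proof.
move=> sk; elim: phi => [i|c|a IHa b IHb|a IHa b IHb] //=.
- by rewrite add0n mul1n.
- by move: IHa IHb; rewrite !mulSn mulnDl; lia.
- by move: IHa IHb; rewrite !mulSn mulnDl; lia.
Qed.

End FormulaSubst.

Section FormulaEval.

Lemma eval_formula_subst (K : fieldType) m m' (s : 'I_m -> formula K m') phi :
  formula_eval (formula_subst s phi) =
  mmap (@mpolyC m' K) (fun i => formula_eval (s i)) (formula_eval phi).
Proof.
elim: phi => [i|c|a IHa b IHb|a IHa b IHb] /=.
- by rewrite mmapX mmap1U.
- by rewrite mmapC.
- by rewrite IHa IHb mmapD.
- by rewrite IHa IHb rmorphM.
Qed.

Lemma eval_formula_map (K L : fieldType) m (h : {rmorphism K -> L}) (phi : formula K m) :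
  formula_eval (formula_map h phi) = map_mpoly h (formula_eval phi).
Proof.
elim: phi => [i|c|a IHa b IHb|a IHa b IHb] /=.
- by rewrite map_mpolyX.
- by rewrite map_mpolyC.
- by rewrite IHa IHb rmorphD.
- by rewrite IHa IHb rmorphM.
Qed.

(** The degree is at most the number of leaves, which is one more than the size; [msize] adds
    another one. *)
Lemma msize_formula_eval (K : fieldType) m (phi : formula K m) :
  (msize (formula_eval phi) <= (formula_size phi).+2)%N.
Proof.
elim: phi => [i|c|a IHa b IHb|a IHa b IHb] /=.
- by rewrite msizeX mdeg1.
- by rewrite msizeC; case: (c == 0).
- by apply: leq_trans (msizeD_le _ _) _; rewrite geq_max; lia.
- have [->|nza] := eqVneq (formula_eval a) 0; first by rewrite mul0r msize0.
  have [->|nzb] := eqVneq (formula_eval b) 0; first by rewrite mulr0 msize0.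
  rewrite msizeM //; move: IHa IHb.
  move: (msize _) (msize _) (formula_size a) (formula_size b) => x y u v.
  lia.
Qed.

End FormulaEval.

Section BorderComplexity.
Variable F : fieldType.
Implicit Types m S : nat.
Local Notation eps0 := (horner_eval (0 : F)).

(** Border complexity at most [S], phrased with a lift of [p0] to F[eps] and the morphism
    [eps := 0]. In this form it passes directly through sums, products and substitutions. *)
Definition border_le m (p0 : {mpoly F[m]}) (S : nat) : Prop :=
  exists (phi : formula {fraction {poly F}} m) (p : {mpoly {poly F}[m]}),
    [/\ (formula_size phi <= S)%N, formula_eval phi = map_mpoly (@tofrac {poly F}) p
      & map_mpoly eps0 p = p0].

Lemma border_le_weak m (p : {mpoly F[m]}) S S' :
  (S <= S')%N -> border_le p S -> border_le p S'.
Proof. by move=> h [phi [q [s e e']]]; exists phi, q; split=> //; apply: leq_trans h. Qed.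

Lemma border_le_const m (c : F) : border_le (c%:MP : {mpoly F[m]}) 0.
Proof.
exists (FConst m (tofrac c%:P)), (c%:P)%:MP; split; [by [] | by rewrite /= map_mpolyC |].
by rewrite map_mpolyC /= horner_evalE hornerC.
Qed.

Lemma border_le_var m (i : 'I_m) : border_le ('X_i : {mpoly F[m]}) 0.
Proof. by exists (FVar _ i), 'X_i; split; rewrite //= map_mpolyX. Qed.

Lemma border_le_add m (p q : {mpoly F[m]}) S S' :
  border_le p S -> border_le q S' -> border_le (p + q) (S + S').+1.
Proof.
move=> [f [p' [s e e']]] [g [q' [s' d d']]]; exists (FAdd f g), (p' + q').
by split; [rewrite /= ltnS leq_add | rewrite /= rmorphD e d | rewrite rmorphD /= e' d'].
Qed.

Lemma border_le_mul m (p q : {mpoly F[m]}) S S' :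
  border_le p S -> border_le q S' -> border_le (p * q) (S + S').+1.
Proof.
move=> [f [p' [s e e']]] [g [q' [s' d d']]]; exists (FMul f g), (p' * q').
by split; [rewrite /= ltnS leq_add | rewrite /= rmorphM e d | rewrite rmorphM /= e' d'].
Qed.

Lemma border_le_sum m n (p : 'I_n -> {mpoly F[m]}) S :
  (forall i, border_le (p i) S) -> border_le (\sum_(i < n) p i) (n * S.+1).
Proof.
elim: n p => [|n IHn] p h.
  by rewrite big_ord0 -mpolyC0; apply: border_le_const.
rewrite big_ord_recl mulSn addSn; apply: border_le_add => //.
by apply: IHn => i; apply: h.
Qed.

Lemma border_le_exp m (p : {mpoly F[m]}) n S :
  border_le p S -> border_le (p ^+ n) (n * S.+1).
Proof.
move=> h; elim: n => [|n IHn]; first by rewrite expr0 -mpolyC1; apply: border_le_const.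
by rewrite exprS mulSn addSn; apply: border_le_mul.
Qed.

Lemma border_le_comp m n (p : {mpoly F[n]}) (q : 'I_n -> {mpoly F[m]}) S S' :
  border_le p S -> (forall i, border_le (q i) S') ->
  border_le (mmap (@mpolyC m F) q p) (S + S.+1 * S').
Proof.
move=> [f [p' [s e e']]] /fin_all_exists[g /fin_all_exists[q' h]].
exists (formula_subst g f), (mmap (@mpolyC m {poly F}) q' p'); split.
- have gS' i : (formula_size (g i) <= S')%N by case: (h i).
  apply: leq_trans (size_formula_subst _ gS') _.
  by rewrite leq_add // leq_mul2r ltnS s orbT.
- rewrite eval_formula_subst map_mpoly_mmap e.
  by apply: eq_mmap => // i /=; case: (h i).
- rewrite map_mpoly_mmap e'.
  by apply: eq_mmap => // i /=; case: (h i).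
Qed.

(** Setting [eps := 0] can only shrink the support and the embedding into F(eps) preserves it, so
    the degree bound for formulas passes to the limit. *)
Lemma msize_border_le m (p : {mpoly F[m]}) S : border_le p S -> (msize p <= S.+2)%N.
Proof.
move=> [f [p' [s e <-]]].
have : (msize (formula_eval f) <= S.+2)%N.
  by apply: leq_trans (msize_formula_eval _) _; rewrite !ltnS.
rewrite e; apply: leq_trans; apply: msize_subset => t.
rewrite !mcoeff_msupp !mcoeff_map_mpoly tofrac_eq0.
by apply: contra_neq => ->; rewrite raddf0.
Qed.

(** [drop_poly 1] removes the constant term in eps of each coefficient and divides the rest by eps,
    which supplies the witness [g]. *)
Lemma border_le_formula m (p : {mpoly F[m]}) S : border_le p S ->
  exists2 phi, border_formula phi p & (formula_size phi <= S)%N.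
Proof.
move=> [f [p' [s e <-]]]; exists f => //.
exists (map_mpoly (drop_poly 1) p'); rewrite e; congr (map_mpoly _ _).
apply/mpolyP => t; rewrite mcoeffD mcoeffZ !mcoeff_map_mpoly.
rewrite -{1}[p'@_t](poly_take_drop 1) expr1 [RHS]addrC mulrC addrC; congr (_ + _).
apply/polyP => i; rewrite coef_take_poly coefC /= horner_evalE horner_coef0.
by case: i.
Qed.

End BorderComplexity.

(** * Leading minors and LDU decomposition *)

Section LeadingMinors.

(** Padding the leading block by the identity makes every leading minor, including the empty one, a
    determinant of the same size [n]. *)
Definition lead_pad (R : pzRingType) n (k : nat) (M : 'M[R]_n) : 'M[R]_n :=
  \matrix_(i, j) if (i < k)%N && (j < k)%N then M i j else (i == j)%:R.

(** One condition covers both the unit diagonal and the vanishing above it. *)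
Definition unit_lower (R : pzRingType) n (L : 'M[R]_n) : Prop :=
  forall i j : 'I_n, (i <= j)%N -> L i j = (i == j)%:R.

Lemma lead_pad0 (R : pzRingType) n (M : 'M[R]_n) : lead_pad 0 M = 1%:M.
Proof. by apply/matrixP => i j; rewrite !mxE. Qed.

Lemma map_lead_pad (R S : pzRingType) (f : {rmorphism R -> S}) n k (M : 'M[R]_n) :
  map_mx f (lead_pad k M) = lead_pad k (map_mx f M).
Proof. by apply/matrixP => i j; rewrite !mxE; case: ifP; rewrite ?rmorph_nat. Qed.

Lemma det_lead_pad_block (R : comNzRingType) k d (M : 'M[R]_(k + d)) :
  \det (lead_pad k M) = \det (ulsubmx M).
Proof.
rewrite (_ : lead_pad k M = block_mx (ulsubmx M) 0 0 1%:M) ?det_ublock ?det1 ?mulr1 //.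
have kk j : (k + j < k)%N = false by rewrite ltnNge leq_addr.
apply/matrixP => i j; rewrite mxE.
case: (split_ordP i) => i' ->; case: (split_ordP j) => j' -> /=;
  rewrite ?block_mxEul ?block_mxEur ?block_mxEdl ?block_mxEdr !mxE /= ?kk ?ltn_ord
    ?andbF ?eq_lrshift ?eq_rlshift ?eq_rshift //.
Qed.

(** Gaussian elimination without pivoting: the leading minors of the Schur complement of the corner
    entry [a] are those of [M] divided by [a], so they are nonzero and induction applies. *)
Lemma LDU_decomposition (F : fieldType) n (M : 'M[F]_n) :
  (forall i, (i <= n)%N -> \det (lead_pad i M) != 0) ->
  exists L U : 'M[F]_n, exists d : 'I_n -> F,
    [/\ unit_lower L, unit_lower U^T,
        M = L *m diag_mx (\row_i d i) *m U
      & forall i : 'I_n, d i = \det (lead_pad i.+1 M) / \det (lead_pad i M)].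
Proof.
elim: n M => [|n IHn] M hM.
  by exists 0, 0, (fun=> 0); split; do ?[by case]; apply/matrixP; case.
move: M hM; change n.+1 with (1 + n)%N => M hM.
pose a := M 0 0; pose u := ursubmx M; pose v := dlsubmx M; pose W := drsubmx M.
pose Sc := W - a^-1 *: (v *m u).
have padE k : lead_pad k.+1 M =
    block_mx a%:M (\row_j if (j < k)%N then u 0 j else 0)
      (\col_i if (i < k)%N then v i 0 else 0) (lead_pad k W).
  apply/matrixP => i j; rewrite mxE.
  case: (split_ordP i) => i' ->; case: (split_ordP j) => j' -> /=;
    rewrite ?block_mxEul ?block_mxEur ?block_mxEdl ?block_mxEdr !mxE ?eq_lrshift ?eq_rlshift
      ?eq_rshift ?ord1 /= ?add1n ?ltnS ?andbT.
  - by rewrite /a mulr1n; congr (M _ _); apply/val_inj.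
  - by case: ifP => // _; congr (M _ _); apply/val_inj.
  - by case: ifP => // _; congr (M _ _); apply/val_inj.
  - by [].
(* Padding commutes with taking the Schur complement Sc. *)
have detE k : a != 0 -> \det (lead_pad k.+1 M) = a * \det (lead_pad k Sc).
  move=> a0; rewrite padE.
  set u' := \row__ _; set v' := \col__ _.
  have -> : block_mx a%:M u' v' (lead_pad k W) =
     block_mx 1%:M 0 (a^-1 *: v') 1%:M *m block_mx a%:M u' 0 (lead_pad k Sc).
    rewrite mulmx_block !mul1mx !mul0mx !addr0 mul_mx_scalar scalerA divff // scale1r.
    congr block_mx; apply/matrixP => i j; rewrite !mxE big_ord1 !mxE.
    case: (_ < k)%N; case: (_ < k)%N; rewrite /= ?big_ord1; try ring.
    by rewrite !mxE mulrA addrC subrK.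
  by rewrite det_mulmx det_lblock !det1 !mul1r det_ublock det_scalar1.
have a0 : a != 0.
  have := hM 1 isT; rewrite padE lead_pad0.
  set u' := \row__ _; have -> : u' = 0 by apply/matrixP => i j; rewrite !mxE.
  by rewrite det_lblock det_scalar1 det1 mulr1.
have hS i : (i <= n)%N -> \det (lead_pad i Sc) != 0.
  by move=> ii; have := hM i.+1 ii; rewrite detE // mulf_eq0 negb_or => /andP[].
have [L [U [d [uL uU eS dE]]]] := IHn _ hS.
have spl i : split (lshift n i : 'I_(1 + n)) = inl i by exact: (unsplitK (inl i)).
have spr i : split (rshift 1 i : 'I_(1 + n)) = inr i by exact: (unsplitK (inr i)).
exists (block_mx 1%:M 0 (a^-1 *: v) L), (block_mx 1%:M (a^-1 *: u) 0 U).
exists (fun i => if split i is inr j then d j else a); split.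
- move=> i j; case: (split_ordP i) => i' ->; case: (split_ordP j) => j' -> /=;
    rewrite ?block_mxEul ?block_mxEur ?block_mxEdl ?block_mxEdr => ij.
  + by rewrite !ord1 !mxE.
  + by rewrite mxE eq_lrshift.
  + by move: ij; rewrite ord1.
  + by rewrite uL // eq_rshift.
- rewrite tr_block_mx => i j; case: (split_ordP i) => i' ->; case: (split_ordP j) => j' -> /=;
    rewrite ?block_mxEul ?block_mxEur ?block_mxEdl ?block_mxEdr => ij.
  + by rewrite !ord1 !mxE.
  + by rewrite !mxE eq_lrshift.
  + by move: ij; rewrite ord1.
  + by rewrite uU // eq_rshift.
- have -> : diag_mx (\row_(i < 1 + n) (if split i is inr j then d j else a)) =
            block_mx (a%:M : 'M_1) 0 0 (diag_mx (\row_i d i)).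
    apply/matrixP => i j; rewrite !mxE.
    case: (split_ordP i) => i' ->; case: (split_ordP j) => j' -> /=;
      rewrite ?block_mxEul ?block_mxEur ?block_mxEdl ?block_mxEdr !mxE ?ord1 ?spl ?spr
        ?eq_lrshift ?eq_rlshift ?eq_rshift ?eq_lshift ?mxE //.
  rewrite !mulmx_block ?mul1mx ?mul0mx ?mulmx0 ?addr0 ?add0r !mulmx1 !mul_mx_scalar.
  rewrite -eS /Sc mul0mx addr0 mul_scalar_mx !scalerA divff // !scale1r.
  rewrite -{1}[M]submxK; congr block_mx.
  + by apply/matrixP => i j; rewrite !mxE !ord1 mulr1n; congr (M _ _); apply/val_inj.
  + by rewrite addrC -scalemxAr subrK.
- move=> i; case: (split_ordP i) => i' ->.
  + rewrite ord1 /= detE // !lead_pad0 !det1.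
    by rewrite mulr1 divr1.
  + rewrite dE /= -![(1 + i')%N]/(i'.+1) !detE //.
    by rewrite -mulf_div divff // mul1r.
Qed.

End LeadingMinors.

(** * Degeneration to a product of leading minors *)

Section Formulas.
Variables (K : fieldType) (m : nat).

Definition formula_le (p : {mpoly K[m]}) (S : nat) : Prop :=
  exists2 phi : formula K m, formula_eval phi = p & (formula_size phi <= S)%N.

Lemma formula_le_sum n (p : 'I_n -> {mpoly K[m]}) S :
  (forall i, formula_le (p i) S) -> formula_le (\sum_(i < n) p i) (n * S.+1).
Proof.
elim: n p => [|n IHn] p h; first by exists (FConst m 0); rewrite //= big_ord0.
have [f ef sf] := h ord0; have [g eg sg] := IHn (p \o lift ord0) (fun i => h _).
exists (FAdd f g); first by rewrite /= big_ord_recl ef eg.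
by rewrite /= mulSn addSn ltnS leq_add.
Qed.

Lemma formula_le_monomial (c : K) i : formula_le (c%:MP * 'X_i) 1.
Proof. by exists (FMul (FConst m c) (FVar K i)). Qed.

End Formulas.

Definition mx_eval (R : nzRingType) (S : comNzRingType) n (f : R -> S) (X : 'M[S]_n)
    (p : {mpoly R[n * n]}) : S :=
  mmap f (mxvec X 0) p.

(** The generic matrix over any coefficient ring: it is also needed over F[eps] and over F(eps). *)
Definition var_mx (R : nzRingType) n : 'M[{mpoly R[n * n]}]_n :=
  \matrix_(i, j) 'X_(mxvec_index i j).

Lemma rmorph_mx_eval (R : nzRingType) (S T : comNzRingType) n (f : {rmorphism R -> S})
    (g : {rmorphism S -> T}) (X : 'M[S]_n) (p : {mpoly R[n * n]}) :
  g (mx_eval f X p) = mx_eval (g \o f) (map_mx g X) p.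
Proof.
by rewrite /mx_eval rmorph_mmap; apply: eq_mmap => // i; rewrite -map_mxvec mxE.
Qed.

Lemma eq_mx_eval (R : nzRingType) (S : comNzRingType) n (f f' : R -> S) (X : 'M[S]_n)
    (p : {mpoly R[n * n]}) : f =1 f' -> mx_eval f X p = mx_eval f' X p.
Proof. by move=> e; apply: eq_mmap. Qed.

Lemma mx_eval_vec_mx (R : comNzRingType) n (v : 'I_(n * n) -> R) (p : {mpoly R[n * n]}) :
  mx_eval idfun (vec_mx (\row_i v i)) p = p.@[v].
Proof. by apply: eq_mmap => // i; rewrite vec_mxK mxE. Qed.

Lemma mmap_var_mx (R : nzRingType) (S : comNzRingType) n (f : {rmorphism R -> S})
    (M : 'M[S]_n) : map_mx (mmap f (mxvec M 0)) (var_mx R n) = M.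
Proof. by apply/matrixP => i j; rewrite !mxE mmapX mmap1U mxvecE. Qed.

(** At points free of eps, evaluation acts separately on each coefficient in eps. *)
Lemma coef_meval_polyC (R : comNzRingType) n (v : 'I_n -> R) (p : {mpoly {poly R}[n]}) j :
  (p.@[fun i => (v i)%:P])`_j = (map_mpoly (coefp j) p).@[v].
Proof.
rewrite mevalE coef_sum /map_mpoly /mmap raddf_sum /=; apply: eq_bigr => m _.
rewrite mevalM mevalC mmap1_id mevalX -coefMC; congr (coefp j (_ * _)).
by rewrite rmorph_prod; apply: eq_bigr => i _; rewrite rmorphXn.
Qed.

Section Degeneration.
Variables (F : fieldType) (n : nat) (f : {mpoly F[n * n]}).
Hypothesis charF0 : [pchar F] =i pred0.
Local Notation N := (n * n + n * n)%N.
Local Notation R0 := {mpoly F[N]}.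

Definition pair_val (S : Type) (A B : 'M[S]_n) (i : 'I_N) : S :=
  match split i with inl j => mxvec A 0 j | inr j => mxvec B 0 j end.

Definition gen_left : 'M[R0]_n := \matrix_(i, j) 'X_(lshift _ (mxvec_index i j)).
Definition gen_right : 'M[R0]_n := \matrix_(i, j) 'X_(rshift _ (mxvec_index i j)).

(* The polynomial f(A diag(y) B) in y, over the ring of the entries of A and B. *)
Definition diag_expansion : {mpoly R0[n]} :=
  mx_eval (@mpolyC n R0 \o @mpolyC N F)
    (map_mx (@mpolyC n R0) gen_left *m diag_mx (\row_i 'X_i)
      *m map_mx (@mpolyC n R0) gen_right) f.
Local Notation P := diag_expansion.

Lemma mmap_gen (S : comNzRingType) (iota : {rmorphism F -> S}) (A B : 'M[S]_n) :
  map_mx (mmap iota (pair_val A B)) gen_left = A /\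
  map_mx (mmap iota (pair_val A B)) gen_right = B.
Proof.
split; apply/matrixP => i j; rewrite !mxE mmapX mmap1U /pair_val.
  by rewrite (unsplitK (inl (mxvec_index i j))) mxvecE.
by rewrite (unsplitK (inr (mxvec_index i j))) mxvecE.
Qed.

(** The morphism is arbitrary because both evaluations at points and substitutions acting only on
    the coefficients or only on [y] are instances. *)
Lemma rmorph_diag_expansion (S : comNzRingType) (h : {rmorphism {mpoly R0[n]} -> S})
    (iota : F -> S) (A B : 'M[S]_n) (y : 'I_n -> S) :
  (forall c, h (c%:MP)%:MP = iota c) ->
  map_mx h (map_mx (@mpolyC n R0) gen_left) = A ->
  map_mx h (map_mx (@mpolyC n R0) gen_right) = B ->
  (forall i, h 'X_i = y i) ->
  h P = mx_eval iota (A *m diag_mx (\row_i y i) *m B) f.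
Proof.
move=> hi hA hB hy; rewrite /diag_expansion (rmorph_mx_eval _ h) !map_mxM hA hB.
have -> : map_mx h (diag_mx (\row_i 'X_i)) = diag_mx (\row_i y i).
  rewrite map_diag_mx; congr diag_mx.
  by apply/rowP => i; rewrite !mxE hy.
exact: eq_mx_eval.
Qed.

Lemma mmap_diag_expansion (S : comNzRingType) (iota : {rmorphism F -> S})
    (A B : 'M[S]_n) (y : 'I_n -> S) :
  mmap (mmap iota (pair_val A B)) y P =
  mx_eval iota (A *m diag_mx (\row_i y i) *m B) f.
Proof.
have [eA eB] := mmap_gen iota A B.
pose h : {rmorphism {mpoly R0[n]} -> S} := mmap (mmap iota (pair_val A B)) y.
have hC (X : 'M[R0]_n) : map_mx h (map_mx (@mpolyC n R0) X) =
    map_mx (mmap iota (pair_val A B)) X.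
  by apply/matrixP => i j; rewrite !mxE; exact: mmapC.
apply: (rmorph_diag_expansion (h := h)); rewrite ?hC // => c.
  by rewrite [LHS]mmapC /= mmapC.
by rewrite [LHS]mmapX mmap1U.
Qed.

(** For [B = 1] and [y = 1] the expansion specializes to [f(A)], which is nonzero for some [A]. *)
Lemma diag_expansion_neq0 : f != 0 -> P != 0.
Proof.
move=> /(mpoly_neq0_point charF0)[v fv].
have := mmap_diag_expansion idfun (vec_mx (\row_i v i)) 1%:M (fun _ => 1).
rewrite mulmx1 (_ : diag_mx _ = 1%:M); last first.
  by apply/matrixP => i j; rewrite !mxE.
rewrite mulmx1 mx_eval_vec_mx => e.
by apply: contra_neq fv => P0; rewrite -e P0 mmap0.
Qed.

Lemma diag_perm (S : comNzRingType) (A B : 'M[S]_n) (y : 'I_n -> S) (s : 'S_n) :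
  col_perm s A *m diag_mx (\row_i y (s i)) *m row_perm s B =
  A *m diag_mx (\row_i y i) *m B.
Proof.
apply/matrixP => i j; rewrite !mxE [RHS](reindex_inj (@perm_inj _ s)) /=.
by apply: eq_bigr => k _; rewrite !mul_mx_diag !mxE.
Qed.


(** Renaming the generic entries of [A] and [B] by a permutation has the same effect as permuting
    the [y_i]. The renaming is a ring morphism and carries each coefficient to the one at the
    permuted monomial. *)
Lemma mcoeff_diag_expansion_perm (s : 'S_n) :
  exists g : {rmorphism R0 -> R0}, forall m, g P@_m = P@_[multinom m (s i) | i < n].
Proof.
pose t := (s^-1)%g.
have [g [gA gB gC0]] : exists g : {rmorphism R0 -> R0},
    [/\ map_mx g gen_left = col_perm t gen_left,
        map_mx g gen_right = row_perm t gen_right & forall c : F, g c%:MP = c%:MP].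
  have [eA eB] := mmap_gen (@mpolyC N F) (col_perm t gen_left) (row_perm t gen_right).
  exists (mmap (@mpolyC N F) (pair_val (col_perm t gen_left) (row_perm t gen_right))).
  by split=> // c; exact: mmapC.
suff gP : map_mpoly g P = msym s P.
  exists g => m; apply: etrans (esym (mcoeff_map_mpoly g m P)) _.
  exact: etrans (congr1 (mcoeff m) gP) (mcoeff_sym P s m).
pose CC := @mpolyC n R0 \o @mpolyC N F.
have eg : map_mpoly g P = mx_eval CC (map_mx (@mpolyC n R0) (col_perm t gen_left)
    *m diag_mx (\row_i 'X_i) *m map_mx (@mpolyC n R0) (row_perm t gen_right)) f.
  have hC (X : 'M[R0]_n) : map_mx (map_mpoly g) (map_mx (@mpolyC n R0) X) =
      map_mx (@mpolyC n R0) (map_mx g X).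
    by apply/matrixP => i j; rewrite !mxE; exact: map_mpolyC.
  apply: (rmorph_diag_expansion (h := map_mpoly g)).
  - by move=> c; rewrite [LHS]map_mpolyC /= gC0.
  - by rewrite hC gA.
  - by rewrite hC gB.
  - by move=> i; exact: map_mpolyX.
have es : msym s P = mx_eval CC (map_mx (@mpolyC n R0) gen_left
    *m diag_mx (\row_i 'X_(s i)) *m map_mx (@mpolyC n R0) gen_right) f.
  have hC (X : 'M[R0]_n) : map_mx (msym s) (map_mx (@mpolyC n R0) X) =
      map_mx (@mpolyC n R0) X.
    by apply/matrixP => i j; rewrite !mxE; exact: mmapC.
  apply: (rmorph_diag_expansion (h := msym s)); rewrite ?hC // => i.
  - exact: mmapC.
  - by rewrite [LHS]mmapX mmap1U.
suff E : map_mx (@mpolyC n R0) (col_perm t gen_left)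
    *m diag_mx (\row_i 'X_i) *m map_mx (@mpolyC n R0) (row_perm t gen_right) =
    map_mx (@mpolyC n R0) gen_left *m diag_mx (\row_i 'X_(s i))
    *m map_mx (@mpolyC n R0) gen_right.
  exact: etrans eg (etrans (congr1 (fun M => mx_eval CC M f) E) (esym es)).
rewrite map_col_perm map_row_perm -[RHS](diag_perm _ _ _ t).
have -> : \row_i 'X_(s (t i)) = \row_i 'X_i :> 'rV[{mpoly R0[n]}]_n.
  by apply/rowP => i; rewrite !mxE permKV.
by [].
Qed.

Variable b : nat.
Hypothesis b_gt1 : (1 < b)%N.
Hypothesis b_big : (msize P <= b)%N.
Hypothesis f_neq0 : f != 0.

(** Distinct monomials of the support have distinct weights, so the least weight is attained only
    once. *)
Lemma min_weight_exists : exists2 m0, m0 \in msupp P &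
  forall m, m \in msupp P -> m != m0 -> (mweight_base b m0 < mweight_base b m)%N.
Proof.
have ex : exists k, has (fun m => mweight_base b m == k) (msupp P).
  exists (mweight_base b (mlead P)); apply/hasP; exists (mlead P) => //.
  by apply: mlead_supp; apply: diag_expansion_neq0.
case: (ex_minnP ex) => k /hasP[m0 m0P /eqP <-] kmin.
exists m0 => // m mP ne; rewrite ltn_neqAle kmin ?andbT; last first.
  by apply/hasP; exists m.
by apply: contra_neq ne => /(mweight_base_inj b_big m0P mP).
Qed.

Variable m0 : 'X_{1..n}.
Hypothesis m0_supp : m0 \in msupp P.
Hypothesis m0_min :
  forall m, m \in msupp P -> m != m0 -> (mweight_base b m0 < mweight_base b m)%N.

(* Permuting the columns of A and the rows of B permutes the support. *)
Lemma min_weight_sorted (i j : 'I_n) : (i < j)%N -> (m0 j <= m0 i)%N.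
Proof.
clear b_big f_neq0; move=> ij; rewrite leqNgt; apply/negP => lt.
pose s := tperm i j; pose m1 := [multinom m0 (s i) | i < n].
have m1E k : m1 k = m0 (s k) by rewrite mnmE.
have ne : i != j by apply: contraTneq ij => ->; rewrite ltnn.
have m1P : m1 \in msupp P.
  have [g gE] := mcoeff_diag_expansion_perm s.
  rewrite mcoeff_msupp; apply/eqP => z.
  have := gE m1; rewrite z rmorph0 => /esym /eqP; rewrite mcoeff_eq0.
  have -> : [multinom m1 (s i) | i < n] = m0.
    by apply/mnmP => k; rewrite mnmE m1E tpermK.
  by rewrite m0_supp.
have /(m0_min m1P) : m1 != m0.
  by apply: contraTneq lt => e; rewrite -{2}e m1E /s tpermR ltnn.
(* Exchange argument: moving the larger exponent to the smaller power of [b] cannot increase the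
   weight. *)
apply/negP; rewrite -leqNgt /mweight_base.
have ji : j != i by rewrite eq_sym.
rewrite (bigD1 i) //= (bigD1 j) //= [X in (_ <= X)%N](bigD1 i) //= [X in (_ <= _ + X)%N](bigD1 j) //=.
rewrite !m1E {1 2}/s tpermL tpermR !addnA.
rewrite (eq_bigr (fun k : 'I_n => m0 k * b ^ k)%N); last first.
  by move=> k /andP[ki kj]; rewrite m1E /s tpermD // eq_sym.
rewrite leq_add2r.
have : (b ^ i <= b ^ j)%N by rewrite leq_exp2l // ltnW.
move: (b ^ i)%N (b ^ j)%N (m0 i) (m0 j) lt => x y u v; nia.
Qed.

Lemma min_weight_coef_point :
  exists A B : 'M[F]_n, mmap idfun (pair_val A B) P@_m0 != 0.
Proof.
have /(mpoly_neq0_point charF0)[v nz] : P@_m0 != 0 by rewrite -mcoeff_msupp.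
exists (vec_mx (\row_i v (lshift _ i))), (vec_mx (\row_i v (rshift _ i))).
apply: contra_neq nz => <-; apply: eq_mmap => // i; rewrite /pair_val !vec_mxK.
by case: (split_ordP i) => j ->; rewrite !mxE.
Qed.

End Degeneration.

(** * The dominant term under the torus action *)

Section LeadingTerm.
Variables (F : fieldType) (n : nat) (f : {mpoly F[n * n]}).
Hypothesis charF0 : [pchar F] =i pred0.
Local Notation P := (diag_expansion f).
Variable b : nat.
Hypothesis b_gt1 : (1 < b)%N.
Variable m0 : 'X_{1..n}.

Lemma rank_diag_le r (v : 'I_n -> F) : (forall i : 'I_n, (r <= i)%N -> v i = 0) ->
  (\rank (diag_mx (\row_i v i)) <= r)%N.
Proof.
move=> v0; case: (leqP n r) => [nr|/ltnW rn].
  by apply: leq_trans (rank_leq_row _) nr.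
have -> : diag_mx (\row_i v i) = diag_mx (\row_i v i) *m pid_mx r.
  apply/matrixP => i j; rewrite mul_diag_mx !mxE.
  rewrite -val_eqE; case: eqP => _ /=; last by rewrite mulr0 mulr0n.
  by case: ltnP => [_|/v0 ->]; rewrite ?mulr1 ?mulr0.
by apply: leq_trans (mxrankM_maxr _ _) _; rewrite rank_pid_mx.
Qed.

(** If [m0 i = 0] with [i <= r], sortedness confines [m0] to the variables [y_j] with [j < r].
    Setting the other [y_j] to zero keeps the coefficient of [m0], yet kills the expansion, as
    [A diag(y) B] then has rank at most [r]. *)
Lemma min_weight_positive r :
  (forall M : 'M[F]_n, (\rank M <= r)%N -> mx_eval idfun M f = 0) ->
  m0 \in msupp P -> (forall i j : 'I_n, (i < j)%N -> (m0 j <= m0 i)%N) ->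
  forall i : 'I_n, (i <= r)%N -> (0 < m0 i)%N.
Proof.
move=> frank m0P m0s i ir; rewrite lt0n; apply/negP => /eqP m0i.
have m0j (j : 'I_n) : (r <= j)%N -> m0 j = 0%N.
  move=> rj; have := leq_trans ir rj; rewrite leq_eqVlt => /orP[/eqP/val_inj <- //|/m0s].
  by rewrite m0i leqn0 => /eqP.
have [A [B kap]] := min_weight_coef_point charF0 m0P.
pose theta : {rmorphism {mpoly F[n * n + n * n]} -> F} := mmap idfun (pair_val A B).
pose y (j : 'I_n) : {mpoly F[n]} := if (j < r)%N then 'X_j else 0.
pose Q : {mpoly F[n]} := mmap (@mpolyC n F \o theta) y P.
have Q0 : Q = 0.
  apply: (mpoly_eq0_points charF0) => v.
  rewrite /meval /Q rmorph_mmap.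
  rewrite (eq_mmap (f' := mmap idfun (pair_val A B))
             (h' := fun j : 'I_n => if (j < r)%N then v j else 0)).
  - rewrite mmap_diag_expansion; apply: frank.
    rewrite -mulmxA; apply: leq_trans (mxrankM_maxr _ _) _.
    apply: leq_trans (mxrankM_maxl _ _) _; apply: rank_diag_le => j.
    by rewrite leqNgt => /negPf ->.
  - by move=> c /=; rewrite mmapC.
  - by move=> j /=; rewrite /y; case: ifP => _; rewrite ?mmap0 // mmapX mmap1U.
have yX (m : 'X_{1..n}) : mmap1 y m =
    if [forall j : 'I_n, (r <= j)%N ==> (m j == 0%N)] then 'X_[m] else 0.
  case: ifP => [/forallP h|/negbT/forallPn[j]].
    rewrite mpolyXE_id; apply: eq_bigr => j _; rewrite /y.
    by case: ltnP => // rj; have := h j; rewrite rj => /eqP ->; rewrite !expr0.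
  rewrite negb_imply => /andP[rj mj].
  by rewrite /mmap1 (bigD1 j) //= /y ltnNge rj /= expr0n (negPf mj) mul0r.
have := kap; rewrite -[mmap _ _ _]/(theta P@_m0).
suff -> : theta P@_m0 = Q@_m0 by rewrite Q0 mcoeff0 eqxx.
have -> : Q = \sum_(m <- msupp P) (theta P@_m)%:MP * mmap1 y m by [].
rewrite (bigD1_seq m0 m0P (msupp_uniq _)) mcoeffD mcoeffCM yX ifT; last first.
  by apply/forallP => j; apply/implyP => /m0j ->.
rewrite mcoeffX eqxx mulr1 [X in _ + X](raddf_sum (mcoeff m0)) big1 ?addr0 // => m mm0.
by rewrite /= mcoeffCM yX; case: ifP; rewrite ?mcoeff0 ?mulr0 // mcoeffX (negPf mm0) mulr0.
Qed.

Hypothesis m0_supp : m0 \in msupp P.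
Hypothesis m0_min :
  forall m, m \in msupp P -> m != m0 -> (mweight_base b m0 < mweight_base b m)%N.
Variables A B : 'M[F]_n.
Local Notation kappa := (mmap idfun (pair_val A B) P@_m0).
Local Notation polyM := (map_mx (@polyC F)).

Definition torus_mx : 'M[{poly F}]_n := diag_mx (\row_i 'X^(b ^ i)).
Local Notation T := torus_mx.

(* T L T^-1, polynomial in eps for lower triangular L. *)
Definition torus_conj (L : 'M[F]_n) : 'M[{poly F}]_n :=
  \matrix_(i, j) ((L i j)%:P * 'X^(b ^ i - b ^ j)).

(** The truncated subtraction in [torus_conj] is harmless: where it truncates, above the diagonal,
    [L] vanishes. *)
Lemma torus_conjE L : unit_lower L -> T *m polyM L = torus_conj L *m T.
Proof.
move=> uL; apply/matrixP => i j; rewrite mul_diag_mx mul_mx_diag !mxE.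
case: (leqP j i) => [ji|/ltnW ij].
  by rewrite mulrC -mulrA -exprD subnK // leq_exp2l.
rewrite (uL _ _ ij); have [->|_] := eqVneq i j; last by rewrite polyC0 !(mulr0, mul0r).
by rewrite subnn expr0 !mulr1 mul1r.
Qed.

(** Below the diagonal the exponent [b ^ i - b ^ j] is positive because [b > 1], so only the unit
    diagonal survives. *)
Lemma torus_conj_eps0 L : unit_lower L -> map_mx (horner_eval 0) (torus_conj L) = 1%:M.
Proof.
move=> uL; apply/matrixP => i j; rewrite !mxE horner_evalE hornerM hornerC hornerXn.
have [ij|ji] := leqP i j.
  rewrite (uL _ _ ij); have [->|_] := eqVneq i j; last by rewrite mul0r.
  by rewrite subnn mulr1.
rewrite expr0n subn_eq0 leqNgt ltn_exp2l // ji mulr0.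
by rewrite -val_eqE gtn_eqF.
Qed.

(** Moving the torus past [L] and [U] leaves factors congruent to 1 modulo eps and the diagonal
    entries [y_i = eps ^ (2 b^i) d_i]. A monomial in [y] then carries eps to twice its weight, so
    [m0] gives the lowest term. *)
Lemma leading_term_LDU (L U : 'M[F]_n) (d : 'I_n -> F) :
  unit_lower L -> unit_lower U^T ->
  exists z, mx_eval polyC (polyM A *m T *m polyM (L *m diag_mx (\row_i d i) *m U)
      *m T *m polyM B) f =
    'X^(2 * mweight_base b m0) * ((kappa * \prod_i d i ^+ m0 i)%:P + 'X * z).
Proof.
move=> uL uU.
pose A' := polyM A *m torus_conj L.
pose B' := (torus_conj U^T)^T *m polyM B.
have trT : T^T = T by rewrite /T tr_diag_mx.
have UT : polyM U *m T = T *m (torus_conj U^T)^T.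
  apply: trmx_inj; rewrite !trmx_mul trT trmxK -torus_conjE //.
  by rewrite map_trmx.
pose y (i : 'I_n) : {poly F} := 'X^(2 * b ^ i) * (d i)%:P.
have E : polyM A *m T *m polyM (L *m diag_mx (\row_i d i) *m U) *m T *m polyM B =
    A' *m diag_mx (\row_i y i) *m B'.
  have TDT : T *m polyM (diag_mx (\row_i d i)) *m T = diag_mx (\row_i y i).
    rewrite map_diag_mx /torus_mx; apply/matrixP => i j; rewrite mul_mx_diag mxE mul_diag_mx !mxE.
    have [->|_] := eqVneq i j; last by rewrite !mulr0n mulr0 mul0r.
    by rewrite !mulr1n /y mul2n -addnn exprD; ring.
  transitivity (polyM A *m (T *m polyM L) *m polyM (diag_mx (\row_i d i))
                  *m (polyM U *m T) *m polyM B); first by rewrite !map_mxM !mulmxA.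
  by rewrite torus_conjE // UT -TDT !mulmxA.
rewrite E -mmap_diag_expansion.
pose theta : {rmorphism {mpoly F[n * n + n * n]} -> {poly F}} := mmap polyC (pair_val A' B').
have yE (m : 'X_{1..n}) : mmap1 y m = 'X^(2 * mweight_base b m) * (\prod_i d i ^+ m i)%:P.
  rewrite /mmap1 /y rmorph_prod /= /mweight_base big_distrr /= -prodrXr -big_split /=.
  by apply: eq_bigr => i _; rewrite exprMn rmorphXn /= -exprM mulnAC mulnA.
have th0 : exists z0, theta P@_m0 = kappa%:P + 'X * z0.
  have e0 : (theta P@_m0).[0] = kappa.
    rewrite -horner_evalE /theta rmorph_mmap; apply: eq_mmap => [c|i] /=.
      by rewrite horner_evalE hornerC.
    have polyM0 (X : 'M[F]_n) : map_mx (horner_eval 0) (polyM X) = X.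
      by apply/matrixP => k l; rewrite !mxE horner_evalE hornerC.
    have A'0 : map_mx (horner_eval 0) A' = A.
      by rewrite /A' map_mxM polyM0 torus_conj_eps0 // mulmx1.
    have B'0 : map_mx (horner_eval 0) B' = B.
      by rewrite /B' map_mxM polyM0 -map_trmx torus_conj_eps0 // trmx1 mul1mx.
    rewrite /pair_val -[in RHS]A'0 -[in RHS]B'0 -!map_mxvec.
    by case: (split i) => k; rewrite [RHS]mxE.
  have /dvdpP[z0 e] : 'X %| theta P@_m0 - kappa%:P.
    by rewrite -['X]subr0 -polyC0 dvdp_XsubCl rootE !hornerE e0 subrr.
  by exists z0; rewrite mulrC -e addrC subrK.
have [z0 th0E] := th0.
(* Any other monomial has weight larger by at least one, which leaves a spare factor eps. *)
have th m : m \in msupp P -> m != m0 -> exists z1,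
    theta P@_m * mmap1 y m = 'X^(2 * mweight_base b m0) * ('X * z1).
  move=> mP /(m0_min mP) lt; rewrite yE.
  have [e ->] : exists e, (2 * mweight_base b m = 2 * mweight_base b m0 + (1 + e))%N.
    by exists (2 * mweight_base b m - 2 * mweight_base b m0 - 1)%N; lia.
  exists (theta P@_m * (\prod_i d i ^+ m i)%:P * 'X^e).
  by rewrite !exprD expr1; ring.
have [z1 z1E] : exists z1, \sum_(m <- msupp P | m != m0) theta P@_m * mmap1 y m =
    'X^(2 * mweight_base b m0) * ('X * z1).
  rewrite big_seq_cond; elim/big_ind: _ => [|p q [u ->] [v ->]|m /andP[]].
  - by exists 0; rewrite !mulr0.
  - by exists (u + v); rewrite -!mulrDr.
  - exact: th.
have -> : mmap (mmap polyC (pair_val A' B')) y P =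
  \sum_(m <- msupp P) theta P@_m * mmap1 y m by [].
rewrite (bigD1_seq m0 m0_supp (msupp_uniq _)) z1E th0E yE.
exists (z0 * (\prod_i d i ^+ m0 i)%:P + z1).
rewrite polyCM /=; move: (_%:P) (_%:P) => u v; ring.
Qed.

End LeadingTerm.

(** * The limit polynomial and its border formula *)

Section SemiInvariant.
Variable F : fieldType.
Hypothesis charF0 : [pchar F] =i pred0.

(** Zariski density: [p] times the product of all leading minors vanishes at every point, and that
    product is nonzero at the identity. *)
Lemma mpoly_eq0_lead_minors n (p : {mpoly F[n * n]}) :
  (forall M : 'M[F]_n, (forall i, (i <= n)%N -> \det (lead_pad i M) != 0) ->
     mx_eval idfun M p = 0) -> p = 0.
Proof.
move=> h; pose W : {mpoly F[n * n]} := \prod_(i < n.+1) \det (lead_pad i (var_mx F n)).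
have WE (M : 'M[F]_n) : mx_eval idfun M W = \prod_(i < n.+1) \det (lead_pad i M).
  rewrite /mx_eval /W rmorph_prod /=; apply: eq_bigr => i _.
  by rewrite -det_map_mx map_lead_pad mmap_var_mx.
have W0 : W != 0.
  apply/eqP => W0; have := WE 1%:M; rewrite W0 /mx_eval mmap0 big1 => [/esym/eqP|i _].
    by rewrite oner_eq0.
  by rewrite (_ : lead_pad i 1%:M = 1%:M) ?det1 //; apply/matrixP => k l;
     rewrite !mxE; case: ifP.
suff /eqP : p * W = 0 by rewrite mulf_eq0 (negPf W0) orbF => /eqP.
apply: (mpoly_eq0_points charF0) => v; rewrite -mx_eval_vec_mx.
set M := vec_mx _; rewrite /mx_eval rmorphM /= -!/(mx_eval _ _ _) WE.
case: (boolP [forall i : 'I_n.+1, \det (lead_pad i M) != 0]) => [/forallP nz|].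
  by rewrite h ?mul0r // => i ii; exact: (nz (Ordinal (ii : i < n.+1)%N)).
by move=> /forallPn[i /negPn/eqP z]; rewrite (bigD1 i) //= z mul0r mulr0.
Qed.

Lemma linear_form_formula (K : fieldType) n (C1 C2 : 'M[K]_n) k :
  formula_le (mxvec (map_mx (@mpolyC (n * n) K) C1 *m var_mx K n
    *m map_mx (@mpolyC (n * n) K) C2) 0 k) (n * (n * 2).+1).
Proof.
case/mxvec_indexP: k => i j; rewrite mxvecE.
have -> : (map_mx (@mpolyC (n * n) K) C1 *m var_mx K n *m map_mx (@mpolyC (n * n) K) C2) i j =
    \sum_b \sum_a (C1 i a * C2 b j)%:MP * 'X_(mxvec_index a b).
  rewrite mxE; apply: eq_bigr => c _; rewrite !mxE big_distrl /=; apply: eq_bigr => a _.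
  by rewrite !mxE mpolyCM mulrAC.
by apply: formula_le_sum => c; apply: formula_le_sum => a; apply: formula_le_monomial.
Qed.

(** [H] is [f(C1 X C2)] over F[eps], where coefficients of powers of eps can be read off; over
    F(eps) it is a substitution of linear forms into [f], which formulas can carry out. *)
Lemma bilinear_substitution n (C1 C2 : 'M[{poly F}]_n) (f : {mpoly F[n * n]}) :
  exists H : {mpoly {poly F}[n * n]},
    (forall M : 'M[F]_n, H.@[fun i => (mxvec M 0 i)%:P] =
       mx_eval polyC (C1 *m map_mx polyC M *m C2) f) /\
    map_mpoly (@tofrac {poly F}) H =
      mmap (@mpolyC (n * n) {fraction {poly F}})
        (mxvec (map_mx (@mpolyC (n * n) _) (map_mx (@tofrac {poly F}) C1)
           *m var_mx _ n *m map_mx (@mpolyC (n * n) _) (map_mx (@tofrac {poly F}) C2)) 0)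
        (map_mpoly (@tofrac {poly F} \o polyC) f).
Proof.
pose K := {fraction {poly F}}; pose tf := @tofrac {poly F}.
pose mC := @mpolyC (n * n) {poly F}.
pose X : 'M[{mpoly {poly F}[n * n]}]_n :=
  map_mx mC C1 *m var_mx {poly F} n *m map_mx mC C2.
pose H : {mpoly {poly F}[n * n]} := mx_eval (mC \o polyC) X f.
exists H; split.
  move=> M.
  pose g : {rmorphism {mpoly {poly F}[n * n]} -> {poly F}} := meval (fun i => (mxvec M 0 i)%:P).
  have gC c : g (mC c) = c by exact: mevalC.
  have gCm (Y : 'M[{poly F}]_n) : map_mx g (map_mx mC Y) = Y.
    by apply/matrixP => i j; rewrite !mxE gC.
  have gX : map_mx g (var_mx {poly F} n) = map_mx polyC M.
    by apply/matrixP => i j; rewrite !mxE [LHS]mevalXU mxvecE.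
  rewrite -[LHS]/(g H) /H (rmorph_mx_eval _ g) /X !map_mxM !gCm gX.
  by apply: eq_mx_eval => c; exact: gC.
rewrite mmap_map_mpoly /H.
rewrite (rmorph_mx_eval _ (map_mpoly tf : {rmorphism _ -> _})).
apply: eq_mmap => [c|i]; first by rewrite /= map_mpolyC.
rewrite /X !map_mxM.
have tC (Y : 'M[{poly F}]_n) : map_mx (map_mpoly tf) (map_mx mC Y) =
    map_mx (@mpolyC (n * n) K) (map_mx tf Y).
  by apply/matrixP => k l; rewrite !mxE; exact: map_mpolyC.
have tX : map_mx (map_mpoly tf) (var_mx {poly F} n) = var_mx K n.
  by apply/matrixP => k l; rewrite !mxE; exact: map_mpolyX.
by rewrite !tC tX.
Qed.

(** [h] is the coefficient of [eps ^ q] in [f(A T X T B)], normalized by [kappa]; it is the lowest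
    one, because the leading term is known on a dense set of matrices. *)
Lemma semi_invariant_degeneration n r (f : {mpoly F[n * n]}) (phi : formula F (n * n)) :
  f != 0 -> formula_eval phi = f ->
  (forall M : 'M[F]_n, (\rank M <= r)%N -> mx_eval idfun M f = 0) ->
  exists (mu : 'I_n -> nat) (h : {mpoly F[n * n]}),
  [/\ forall i : 'I_n, (i <= r)%N -> (0 < mu i)%N,
      border_le h (formula_size phi + (formula_size phi).+1 * (n * (n * 2).+1)).+1
    & forall M : 'M[F]_n, (forall i, (i <= n)%N -> \det (lead_pad i M) != 0) ->
        mx_eval idfun M h =
        \prod_(i < n) (\det (lead_pad i.+1 M) / \det (lead_pad i M)) ^+ mu i].
Proof.
move=> f0 phif frank.
pose P := diag_expansion f; pose b := (msize P).+2.
have b1 : (1 < b)%N by [].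
have bP : (msize P <= b)%N by rewrite /b; lia.
have [m0 m0P m0min] := min_weight_exists charF0 bP f0.
have [A [B kap]] := min_weight_coef_point charF0 m0P.
pose kappa : F := mmap idfun (pair_val A B) P@_m0.
have kap0 : kappa != 0 by [].
(* Twice the weight, because the torus acts from both sides. *)
pose q := (2 * mweight_base b m0)%N.
pose C1 := map_mx polyC A *m torus_mx F n b; pose C2 := torus_mx F n b *m map_mx polyC B.
have [H [HM tH]] := bilinear_substitution C1 C2 f.
pose Hc j : {mpoly F[n * n]} := map_mpoly (coefp j) H.
have HcM j (M : 'M[F]_n) : (forall i, (i <= n)%N -> \det (lead_pad i M) != 0) ->
    exists z : {poly F}, mx_eval idfun M (Hc j) =
    ('X^q * ((kappa * \prod_(i < n) (\det (lead_pad i.+1 M) / \det (lead_pad i M)) ^+ m0 i)%:P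
       + 'X * z))`_j.
  move=> nz; have [L [U [d [uL uU eM dE]]]] := LDU_decomposition nz.
  have [z zE] := leading_term_LDU b1 m0P m0min A B d uL uU.
  exists z; rewrite [LHS](esym (coef_meval_polyC _ _ _)) HM /C1 /C2 !mulmxA.
  rewrite [in LHS]eM zE; congr (('X^_ * ((_ * _)%:P + _))`_j).
  by apply: eq_bigr => i _; rewrite dE.
have Hc0 j : (j < q)%N -> Hc j = 0.
  move=> jq; apply: mpoly_eq0_lead_minors => M /(HcM j)[z ->].
  by rewrite coefXnM jq.
have Hct j t : (Hc j)@_t = (H@_t)`_j by exact: mcoeff_map_mpoly.
pose Hd : {mpoly {poly F}[n * n]} := map_mpoly (drop_poly q) H.
have Hdt t : Hd@_t = drop_poly q H@_t by exact: mcoeff_map_mpoly.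
have HE : H = 'X^q *: Hd.
  apply/mpolyP => t; rewrite mcoeffZ Hdt mulrC.
  have t0 : take_poly q H@_t = 0.
    apply/polyP => j; rewrite coef_take_poly.
    rewrite [RHS]coef0; case: ifP => [/Hc0 e|_]; last by [].
    by rewrite -(Hct j t) e mcoeff0.
  by have := poly_take_drop q H@_t; rewrite t0 add0r => e; exact: esym.
exists (fun i => m0 i), (kappa^-1 *: Hc q); split.
- move=> i ir; apply: (min_weight_positive charF0 frank m0P _ ir) => k l.
  exact: (min_weight_sorted b1 m0P m0min).
- pose K := {fraction {poly F}}; pose tf := @tofrac {poly F}.
  have [s sE] := fin_all_exists2 (linear_form_formula (map_mx tf C1) (map_mx tf C2)).
  set bd := (n * _)%N => sbd.
  (* Division by [eps ^ q] is multiplication by a constant of F(eps) and costs a single gate. *)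
  exists (FMul (FConst (n * n) (tf (kappa^-1)%:P / tf 'X^q))
               (formula_subst s (formula_map (tf \o polyC) phi))).
  exists ((kappa^-1)%:P *: Hd); split.
  + rewrite /= add0n ltnS; apply: leq_trans (size_formula_subst _ sbd) _.
    by rewrite size_formula_map.
  + have eH : mmap (@mpolyC (n * n) K) (fun i => formula_eval (s i))
        (map_mpoly (tf \o polyC) f) = map_mpoly tf H.
      by rewrite tH; apply: eq_mmap => // i; rewrite sE.
    have Xq0 : tf 'X^q != 0 by rewrite /tf tofrac_eq0 -size_poly_eq0 size_polyXn.
    rewrite [LHS]/= eval_formula_subst eval_formula_map phif eH.
    rewrite HE.
    rewrite !map_mpolyZ.
    by rewrite mul_mpolyC scalerA mulfVK.
  + rewrite map_mpolyZ /= horner_evalE hornerC; congr (_ *: _).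
    apply/mpolyP => t; rewrite Hct.
    apply: etrans (mcoeff_map_mpoly _ _ _) _.
    by rewrite Hdt /= horner_evalE horner_coef0 coef_drop_poly.
- move=> M /(HcM q)[z e]; rewrite [LHS]mevalZ -[X in _ * X]/(mx_eval idfun M (Hc q)) e.
  by rewrite coefXnM ltnn subnn coefD coefC coefXM addr0 mulKf.
Qed.

End SemiInvariant.

(** * Truncated logarithm and exponential *)

Section TruncatedSeries.
Variable F : fieldType.
Hypothesis charF0 : [pchar F] =i pred0.

(** The coefficient map [c] is a parameter so that the same expression makes sense for polynomials
    in [t], for polynomials in the matrix entries, and for scalars. *)
Definition series_log (R : comNzRingType) (c : F -> R) k (g : R) : R :=
  \sum_(i < k) c ((-1) ^+ i / i.+1%:R) * (g - 1) ^+ i.+1.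

Definition series_exp (R : comNzRingType) (c : F -> R) k (u : R) : R :=
  \sum_(i < k.+1) c (i`!%:R^-1) * u ^+ i.

Lemma rmorph_series_log (R S : comNzRingType) (c : F -> R) (h : {rmorphism R -> S}) k g :
  h (series_log c k g) = series_log (h \o c) k (h g).
Proof.
rewrite rmorph_sum; apply: eq_bigr => i _.
by rewrite rmorphM rmorphXn rmorphB rmorph1.
Qed.

Lemma rmorph_series_exp (R S : comNzRingType) (c : F -> R) (h : {rmorphism R -> S}) k g :
  h (series_exp c k g) = series_exp (h \o c) k (h g).
Proof.
by rewrite rmorph_sum; apply: eq_bigr => i _; rewrite rmorphM rmorphXn.
Qed.

Implicit Types p q g h u v : {poly F}.

Lemma dvdp_XnP k p : reflect (forall i, (i < k)%N -> p`_i = 0) ('X^k %| p).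
Proof.
apply: (iffP idP) => [/dvdpP[q ->] i ik|h]; first by rewrite coefMXn ik.
rewrite -(poly_take_drop k p) (_ : take_poly k p = 0) ?add0r ?dvdp_mull //.
by apply/polyP => i; rewrite coef_take_poly coef0; case: ifP => [/h|_].
Qed.

(** Integration in characteristic zero raises the order of vanishing by one; identities between
    series thus reduce to their derivatives. *)
Lemma dvdp_Xn_deriv k p : p.[0] = 0 -> 'X^k %| p^`() -> 'X^(k.+1) %| p.
Proof.
move=> p0 /dvdp_XnP dp; apply/dvdp_XnP => -[|i] ik; first by rewrite -horner_coef0.
have /eqP := dp i ik; rewrite coef_deriv -mulr_natr mulf_eq0.
by rewrite (natr_eq0_char0 charF0) orbF => /eqP.
Qed.

(** A polynomial with constant term 1 is a unit modulo ['X^k]. *)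
Lemma dvdp_Xn_mulr k g p : g.[0] = 1 -> 'X^k %| p * g -> 'X^k %| p.
Proof.
move=> g0; rewrite Gauss_dvdpl // coprimep_expl // -['X]subr0 -polyC0.
by rewrite coprimep_sym coprimep_XsubC rootE g0 oner_eq0.
Qed.

Lemma dvdp_exp_X u k : u.[0] = 0 -> 'X^k %| u ^+ k.
Proof.
by move=> u0; apply: dvdp_exp2r; rewrite -['X]subr0 -polyC0 dvdp_XsubCl rootE u0.
Qed.

Section Trunc.
Variable k : nat.
Local Notation log := (series_log polyC k).
Local Notation exp := (series_exp polyC k).

Lemma series_log0 g : g.[0] = 1 -> (log g).[0] = 0.
Proof.
move=> g0; rewrite horner_sum big1 // => i _.
by rewrite hornerM horner_exp !hornerE g0 subrr expr0n mulr0.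
Qed.

(** With [u = g - 1], the derivative of the truncated logarithm is [u'] times the truncated
    geometric series of [1 / (1 + u)]. *)
Lemma deriv_series_log g : g.[0] = 1 -> 'X^k %| (log g)^`() * g - g^`().
Proof.
move=> g0; pose u := g - 1.
have u0 : (- u).[0] = 0 by rewrite /u !hornerE g0 subrr oppr0.
have -> : (log g)^`() = u^`() * \sum_(i < k) (- u) ^+ i.
  rewrite raddf_sum /= big_distrr /=; apply: eq_bigr => i _.
  have cE : ((-1) ^+ i / i.+1%:R)%:P * i.+1%:R = (-1) ^+ i :> {poly F}.
    by rewrite -polyC_natr -polyCM divfK ?(natr_eq0_char0 charF0) // rmorphXn rmorphN1.
  rewrite derivM derivC mul0r add0r -/u deriv_exp /= [(- u) ^+ i]exprNn -cE.
  by move: (_%:P) => a; rewrite -mulr_natl; ring.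
have -> : g^`() = u^`() by rewrite /u derivB derivC subr0.
have -> : g = - (- u - 1) by rewrite /u; ring.
rewrite -mulrA mulrN [_ * (- u - 1)]mulrC -subrX1 mulrN -mulNr.
have -> : - u^`() * ((- u) ^+ k - 1) - u^`() = - u^`() * (- u) ^+ k by ring.
by apply: dvdp_mull; apply: dvdp_exp_X.
Qed.

(** Both sides vanish at 0 and have the same derivative modulo ['X^k], by additivity of the
    logarithmic derivative. *)
Lemma series_logM g h : g.[0] = 1 -> h.[0] = 1 ->
  'X^(k.+1) %| log (g * h) - (log g + log h).
Proof.
move=> g0 h0; have gh0 : (g * h).[0] = 1 by rewrite hornerM g0 h0 mulr1.
apply: dvdp_Xn_deriv; first by rewrite !hornerE !series_log0 // addr0 subrr.
apply: (dvdp_Xn_mulr gh0); rewrite derivB derivD.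
set a := (log (g * h))^`(); set lg := (log g)^`(); set lh := (log h)^`().
have -> : (a - (lg + lh)) * (g * h) = (a * (g * h) - (g * h)^`())
   - (lg * g - g^`()) * h - (lh * h - h^`()) * g by rewrite derivM; ring.
apply: dvdp_sub; last by apply: dvdp_mulr; apply: deriv_series_log.
by apply: dvdp_sub; [|apply: dvdp_mulr]; apply: deriv_series_log.
Qed.

Lemma series_log1 : log 1 = 0.
Proof. by rewrite /series_log big1 // => i _; rewrite subrr expr0n mulr0. Qed.

Lemma series_logX g m : g.[0] = 1 -> 'X^(k.+1) %| log (g ^+ m) - m%:R * log g.
Proof.
move=> g0; elim: m => [|m IHm]; first by rewrite expr0 series_log1 mul0r subrr dvdp0.
have gm0 : (g ^+ m).[0] = 1 by rewrite horner_exp g0 expr1n.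
have -> : log (g ^+ m.+1) - m.+1%:R * log g =
  log (g * g ^+ m) - (log g + log (g ^+ m)) + (log (g ^+ m) - m%:R * log g).
  by rewrite exprS -natr1; ring.
by rewrite dvdp_add ?series_logM.
Qed.

Lemma series_exp_congr u v : 'X^(k.+1) %| u - v -> 'X^(k.+1) %| exp u - exp v.
Proof.
move=> uv; rewrite /series_exp -sumrB; elim/big_ind: _ => [|p q|i _].
- exact: dvdp0.
- exact: dvdp_add.
by rewrite -mulrBr subrXX dvdp_mull // dvdp_mulr.
Qed.

(** Both [exp l] and [g] solve [y' = l' y] modulo ['X^k] with value 1 at 0. Their difference [q]
    satisfies [q' g = g' q] modulo ['X^k], so its order of vanishing climbs one step at a time to
    [k.+1]. *)
Lemma series_expK g : g.[0] = 1 -> 'X^(k.+1) %| exp (log g) - g.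
Proof.
move=> g0; set l := log g.
have l0 : l.[0] = 0 by apply: series_log0.
have e0 : (exp l).[0] = 1.
  rewrite horner_sum big_ord_recl big1 /= => [|i _].
    by rewrite expr0 mulr1 hornerC fact0 invr1 addr0.
  by rewrite hornerM horner_exp l0 expr0n mulr0.
have dE : 'X^k %| (exp l)^`() - l^`() * exp l.
  have -> : (exp l)^`() = l^`() * \sum_(i < k) (i`!%:R^-1)%:P * l ^+ i.
    rewrite raddf_sum big_ord_recl /= expr0 mulr1 derivC add0r big_distrr /=.
    apply: eq_bigr => i _; rewrite derivM derivC mul0r add0r deriv_exp /= /bump /= add1n.
    have cE : (i.+1`!%:R^-1)%:P * i.+1%:R = (i`!%:R^-1)%:P :> {poly F}.
      rewrite -polyC_natr -polyCM factS natrM invfM mulrAC mulVf ?mul1r //.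
      by rewrite (natr_eq0_char0 charF0).
    by rewrite -cE; move: (_%:P) => a; rewrite -mulr_natl; ring.
  rewrite -mulrBr /series_exp big_ord_recr /= opprD addrA subrr sub0r.
  by rewrite mulrN -mulNr mulrA dvdp_mull // dvdp_exp_X.
have gl := deriv_series_log g0; rewrite -/l in gl.
set q := exp l - g.
have q0 : q.[0] = 0 by rewrite /q hornerD hornerN e0 g0 subrr.
have step j : (j <= k)%N -> 'X^j %| q -> 'X^(j.+1) %| q.
  move=> jk jq; apply: dvdp_Xn_deriv => //; apply: (dvdp_Xn_mulr g0).
  have Xjk : ('X^j : {poly F}) %| 'X^k by apply: dvdp_exp2l.
  have -> : q^`() * g = ((exp l)^`() - l^`() * exp l) * g
     + (l^`() * g - g^`()) * exp l + g^`() * q by rewrite /q derivB; ring.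
  rewrite !dvdp_add //; last exact: dvdp_mull.
    by apply: dvdp_mulr; apply: dvdp_trans dE.
  by apply: dvdp_mulr; apply: dvdp_trans gl.
have : forall j, (j <= k.+1)%N -> 'X^j %| q.
  elim=> [|j IHj] jk; first by rewrite expr0 dvd1p.
  by apply: step => //; apply: IHj; apply: leqW.
exact.
Qed.

End Trunc.
End TruncatedSeries.

(** * Extraction of the determinant *)

Section DegreeBounds.
Variable F : fieldType.
Implicit Types p q : {poly F}.

Definition deg_le p d : Prop := (size p <= d.+1)%N.

Lemma deg_le_const (c : F) d : deg_le c%:P d.
Proof. by apply: leq_trans (size_polyC_leq1 _) _. Qed.

Lemma deg_le_weak p d d' : (d <= d')%N -> deg_le p d -> deg_le p d'.
Proof. by move=> dd /leq_trans; apply. Qed.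

Lemma deg_le_add p q d : deg_le p d -> deg_le q d -> deg_le (p + q) d.
Proof. by move=> hp hq; apply: leq_trans (size_polyD _ _) _; rewrite geq_max hp hq. Qed.

Lemma deg_le_sum (I : Type) (s : seq I) (f : I -> {poly F}) d :
  (forall i, deg_le (f i) d) -> deg_le (\sum_(i <- s) f i) d.
Proof.
move=> h; elim/big_ind: _ => [|p q|i _]; [|exact: deg_le_add|exact: h].
by rewrite /deg_le size_poly0.
Qed.

Lemma deg_le_opp p d : deg_le p d -> deg_le (- p) d.
Proof. by rewrite /deg_le size_polyN. Qed.

Lemma deg_le_mul p q d d' : deg_le p d -> deg_le q d' -> deg_le (p * q) (d + d').
Proof. by rewrite /deg_le => hp hq; apply: leq_trans (size_polyMleq _ _) _; lia. Qed.

Lemma deg_le_exp p d n : deg_le p d -> deg_le (p ^+ n) (n * d).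
Proof.
move=> h; elim: n => [|n IHn]; first by rewrite expr0 mul0n; apply: deg_le_const.
by rewrite exprS mulSn; apply: deg_le_mul.
Qed.

Lemma deg_le_mmap n (y : 'I_n -> {poly F}) (p : {mpoly F[n]}) d :
  (forall i, deg_le (y i) 1) -> (msize p <= d.+1)%N -> deg_le (mmap polyC y p) d.
Proof.
move=> hy pd; rewrite /mmap big_seq; elim/big_ind: _ => [||m mp].
- exact: (deg_le_const 0).
- by move=> *; apply: deg_le_add.
- rewrite -[d]add0n; apply: deg_le_mul (deg_le_const _ _) _.
  apply: (@deg_le_weak _ (mdeg m)).
    by rewrite -ltnS; apply: leq_trans (msize_mdeg_lt mp) pd.
  rewrite mdegE /mmap1; elim/big_ind2: _ => [|u d1 v d2|i _].
  + exact: (deg_le_const 1).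
  + exact: deg_le_mul.
  + by rewrite -[X in deg_le _ X]muln1; apply: deg_le_exp.
Qed.

End DegreeBounds.

(** * The line [1 + t x] and its leading blocks *)

Section LeadingBlock.
Variables n k : nat.

(** In use [j <= k.+1], so that [inord] keeps the value of the indices it is applied to. *)
Definition block_path (R : pzRingType) (j : nat) (t : R) (x : 'M[R]_k.+1) : 'M[R]_n :=
  \matrix_(a, b) if (a < j)%N && (b < j)%N
                 then (a == b)%:R + t * x (inord a) (inord b) else (a == b)%:R.

(** The leading minors of a path are determinants of paths with smaller blocks, so the pivots of all
    paths are quotients of the same few determinants. *)
Lemma lead_pad_block_path (R : pzRingType) i j (t : R) x :
  lead_pad i (block_path j t x) = block_path (minn i j) t x.
Proof.
apply/matrixP => a b; rewrite !mxE !leq_min.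
by do 4!case: (_ < _)%N.
Qed.

Lemma map_block_path (R S : pzRingType) (f : {rmorphism R -> S}) j (t : R) x :
  map_mx f (block_path j t x) = block_path j (f t) (map_mx f x).
Proof.
apply/matrixP => a b; rewrite !mxE; case: ifP => _; rewrite ?rmorph_nat //.
by rewrite rmorphD rmorphM rmorph_nat.
Qed.

Lemma block_path_eq1 (R : pzRingType) j (x : 'M[R]_k.+1) : block_path j 0 x = 1%:M.
Proof. by apply/matrixP => a b; rewrite !mxE mul0r addr0; case: ifP. Qed.

Lemma block_path0 (R : pzRingType) (t : R) (x : 'M[R]_k.+1) : block_path 0 t x = 1%:M.
Proof. by apply/matrixP => a b; rewrite !mxE. Qed.

End LeadingBlock.

Lemma coef_prod_linear (R : comNzRingType) n (a b : 'I_n -> R) :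
  (\prod_(i < n) ((a i)%:P + 'X * (b i)%:P))`_n = \prod_(i < n) b i.
Proof.
(* The degree bound is carried along because the constant part of a new factor must meet a vanishing
   coefficient. *)
suff [] : (\prod_(i < n) ((a i)%:P + 'X * (b i)%:P))`_n = \prod_(i < n) b i /\
          (size (\prod_(i < n) ((a i)%:P + 'X * (b i)%:P))%R <= n.+1)%N by [].
elim: n a b => [|n IHn] a b.
  by rewrite !big_ord0 coef1 eqxx size_poly1.
rewrite !big_ord_recl /=; have [e s] := IHn (a \o lift ord0) (b \o lift ord0).
move: e s => /=; set p := \prod_(i < n) _ => e s; split.
  rewrite mulrDl coefD coefCM nth_default // mulr0 add0r -mulrA coefXM /= coefCM.
  by rewrite e.
apply: leq_trans (size_polyMleq _ _) _.
have : (size ((a ord0)%:P + 'X * (b ord0)%:P)%R <= 2)%N.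
  apply: leq_trans (size_polyD _ _) _; rewrite geq_max.
  rewrite (leq_trans (size_polyC_leq1 _)) //= mulrC mul_polyC.
  by apply: leq_trans (size_scale_leq _ _) _; rewrite size_polyX.
by move: (size _) (size p) s => u v; lia.
Qed.

(** In the Leibniz expansion each permutation contributes a product of [k.+1] factors linear in [t],
    whose top coefficient is the product of entries of [x]. *)
Lemma coef_det_block_path (F : fieldType) n k (x : 'M[F]_k.+1) : (k < n)%N ->
  (\det (block_path n k.+1 'X (map_mx polyC x)))`_k.+1 = \det x.
Proof.
move=> kn; have [d nE] : exists d, n = (k.+1 + d)%N by exists (n - k.+1)%N; rewrite subnKC.
subst n.
have := @lead_pad_block_path (k.+1 + d) k _ k.+1 k.+1 'X (map_mx polyC x).
rewrite minnn => <-.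
rewrite det_lead_pad_block /determinant coef_sum; apply: eq_bigr => s _.
rewrite -signr_odd -[in RHS]signr_odd.
have -> : (-1) ^+ odd s = ((-1) ^+ odd s)%:P :> {poly F} by rewrite rmorphXn rmorphN1.
rewrite coefCM; congr (_ * _).
rewrite -[RHS](coef_prod_linear (fun i => (i == s i)%:R)).
apply: (congr1 (fun p : {poly F} => p`_k.+1)).
apply: eq_bigr => i _; rewrite !mxE eq_lshift /= !ltn_ord /= !inord_val.
by rewrite -polyC_natr.
Qed.

Section ExtractDeterminant.
Variable F : fieldType.
Hypothesis charF0 : [pchar F] =i pred0.
Variables (n k : nat) (mu : 'I_n -> nat) (h : {mpoly F[n * n]}).
Hypothesis kn : (k < n)%N.
Hypothesis mu_gt0 : forall i : 'I_n, (i <= k)%N -> (0 < mu i)%N.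
Hypothesis h_minors : forall M : 'M[F]_n,
  (forall i, (i <= n)%N -> \det (lead_pad i M) != 0) ->
  mx_eval idfun M h = \prod_(i < n) (\det (lead_pad i.+1 M) / \det (lead_pad i M)) ^+ mu i.

Let mu_ord (j : 'I_k.+1) : 'I_n := widen_ord kn j.

Definition path_value (R : comNzRingType) (c : F -> R) (t : R) (x : 'M[R]_k.+1) (j : nat) : R :=
  mx_eval c (block_path n j t x) h.

(** Congruent to [det (1 + t x)] modulo [t ^ (k + 2)]. The ring is arbitrary: the expression is read
    as a polynomial in [t] for fixed [x], and as a polynomial in [x] for fixed [t]. *)
Definition det_path (R : comNzRingType) (c : F -> R) (t : R) (x : 'M[R]_k.+1) : R :=
  series_exp c k.+1 (\sum_(j < k.+1) c ((mu (mu_ord j))%:R^-1) *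
    (series_log c k.+1 (path_value c t x j.+1) - series_log c k.+1 (path_value c t x j))).

Lemma rmorph_path_value (R S : comNzRingType) (c : {rmorphism F -> R}) (g : {rmorphism R -> S})
    (t : R) (x : 'M[R]_k.+1) j :
  g (path_value c t x j) = path_value (g \o c) (g t) (map_mx g x) j.
Proof. by rewrite /path_value (rmorph_mx_eval _ g) map_block_path. Qed.

Lemma rmorph_det_path (R S : comNzRingType) (c : {rmorphism F -> R}) (g : {rmorphism R -> S})
    (t : R) (x : 'M[R]_k.+1) :
  g (det_path c t x) = det_path (g \o c) (g t) (map_mx g x).
Proof.
rewrite /det_path rmorph_series_exp rmorph_sum; congr (series_exp _ _ _).
apply: eq_bigr => j _; rewrite rmorphM rmorphB !rmorph_series_log.
by rewrite !rmorph_path_value.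
Qed.

Lemma eq_det_path (R : comNzRingType) (c c' : F -> R) (t : R) (x : 'M[R]_k.+1) :
  c =1 c' -> det_path c t x = det_path c' t x.
Proof.
move=> e; rewrite /det_path /series_exp /series_log /path_value.
have em M : mx_eval c M h = mx_eval c' M h by apply: eq_mx_eval.
apply: eq_bigr => i _; rewrite e; congr (_ * _ ^+ _); apply: eq_bigr => j _.
by rewrite e !em; congr (_ * (_ - _)); apply: eq_bigr => l _; rewrite e.
Qed.

Section Point.
Variable x : 'M[F]_k.+1.
Local Notation polyx := (map_mx polyC x).
Let g j := path_value (@polyC F) 'X polyx j.
Let delta j := \det (block_path n j 'X polyx).

Lemma map_horner_polyC (tau : F) : map_mx (horner_eval tau) polyx = x.
Proof. by apply/matrixP => i j; rewrite !mxE horner_evalE hornerC. Qed.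

Lemma horner_path_value tau j : (g j).[tau] = mx_eval idfun (block_path n j tau x) h.
Proof.
rewrite -horner_evalE rmorph_path_value map_horner_polyC /= horner_evalE hornerX.
by apply: eq_mx_eval => c /=; rewrite horner_evalE hornerC.
Qed.

Lemma horner_det_block_path tau j : (delta j).[tau] = \det (block_path n j tau x).
Proof.
by rewrite -horner_evalE -det_map_mx map_block_path map_horner_polyC /= horner_evalE hornerX.
Qed.

Lemma path_value_at0 j : (g j).[0] = 1.
Proof.
rewrite horner_path_value block_path_eq1 h_minors => [|i _].
  rewrite big1 // => i _.
  have e l : lead_pad l 1%:M = 1%:M :> 'M[F]_n.
    by apply/matrixP => a b; rewrite !mxE; case: ifP.
  by rewrite !e det1 divr1 expr1n.
rewrite (_ : lead_pad i 1%:M = 1%:M) ?det1 ?oner_eq0 //.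
by apply/matrixP => a b; rewrite !mxE; case: ifP.
Qed.

Lemma delta_at0 j : (delta j).[0] = 1.
Proof. by rewrite horner_det_block_path block_path_eq1 det1. Qed.

(* Only the pivot of index j differs between the two values. *)
Lemma path_value_step (j : 'I_k.+1) :
  g j.+1 * delta j ^+ mu (mu_ord j) = g j * delta j.+1 ^+ mu (mu_ord j).
Proof.
(* The values of [h] are known only where the leading minors are nonzero, so the identity is checked
   after multiplication by the nonzero polynomial [W]. *)
pose W := \prod_(i < k.+2) delta i.
have W0 : W != 0.
  apply/prodf_neq0 => i _; apply: contra_eq_neq (delta_at0 i) => ->.
  by rewrite horner0 eq_sym oner_eq0.
apply: (mulIf W0); apply/eqP; rewrite -subr_eq0 -mulrBl; apply/eqP.
apply: (poly_eq0_points charF0) => tau; rewrite hornerM.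
have [Wt|Wt] := eqVneq W.[tau] 0; first by rewrite Wt mulr0.
have dt i : (i <= k.+1)%N -> \det (block_path n i tau x) != 0.
  move=> ik; rewrite -horner_det_block_path; move: Wt; rewrite /W horner_prod.
  by move/prodf_neq0 => /(_ (Ordinal (ik : i < k.+2)%N) isT).
have pm l i : (l <= k.+1)%N -> \det (lead_pad i (block_path n l tau x)) != 0.
  by move=> lk; rewrite lead_pad_block_path dt // geq_min lk orbT.
have jk := ltn_ord j.
apply/eqP; rewrite mulf_eq0 (negPf Wt) orbF !hornerE ?horner_exp !horner_path_value.
rewrite !horner_det_block_path !h_minors; try by move=> i _; apply: pm => //; apply: ltnW.
rewrite (bigD1 (mu_ord j)) //= [in X in _ - X](bigD1 (mu_ord j)) //=.
rewrite !lead_pad_block_path minnn (minn_idPl (leqnSn j)) (minn_idPr (leqnSn j)) minnn.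
rewrite divff ?dt ?(ltnW jk) // expr1n mul1r expr_div_n.
set A := \prod_(i < n | _) _; set B := \prod_(i < n | _) _.
suff -> : A = B by rewrite mulrAC divfK ?subrr // ?[_ * B]mulrC ?subrr // expf_neq0 // dt // ltnW.
(* For [i < j] both paths have the same minors; for [i > j] each quotient of minors is 1. *)
apply: eq_bigr => i ij; rewrite !lead_pad_block_path.
have {}ij : (i : nat) != j by apply: contra ij => /eqP e; apply/eqP/val_inj.
case: (ltngtP i j) ij => // ij _.
- by rewrite !(minn_idPl _) // ltnW // ltnW.
- rewrite !(minn_idPr _) //; try lia.
  by rewrite !divff // dt // ltnW.
Qed.

(** Logarithms turn [path_value_step] into [log g_(j+1) - log g_j = mu_j (log delta_(j+1) - log
    delta_j)] modulo [t ^ (k + 2)]. Dividing by [mu_j] and telescoping from [delta_0 = 1] gives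
    [log delta_(k+1)]. *)
Lemma coef_det_path : (det_path (@polyC F) 'X polyx)`_k.+1 = \det x.
Proof.
rewrite -(coef_det_block_path x kn) -/(delta _).
set log := series_log (@polyC F) k.+1.
have cong : 'X^(k.+2) %| det_path (@polyC F) 'X polyx - delta k.+1.
  have -> : det_path (@polyC F) 'X polyx - delta k.+1 =
    (det_path (@polyC F) 'X polyx - series_exp (@polyC F) k.+1 (log (delta k.+1)))
    + (series_exp (@polyC F) k.+1 (log (delta k.+1)) - delta k.+1) by ring.
  apply: dvdp_add (series_expK charF0 _ (delta_at0 _)).
  apply: series_exp_congr.
  have -> : log (delta k.+1) = \sum_(j < k.+1) (log (delta j.+1) - log (delta j)).
    rewrite -(big_mkord xpredT (fun j => log (delta j.+1) - log (delta j))).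
    rewrite telescope_sumr // /delta block_path0 det1 /log.
    by rewrite series_log1 subr0.
  rewrite -sumrB; elim/big_ind: _ => [|p q|j _]; [exact: dvdp0|exact: dvdp_add|].
  set m := mu (mu_ord j).
  have m0 : (m%:R : F) != 0.
    by rewrite (natr_eq0_char0 charF0) -lt0n; apply: mu_gt0; exact: (ltn_ord j).
  have cm : (m%:R^-1)%:P * m%:R = 1 :> {poly F} by rewrite -polyC_natr -polyCM mulVf.
  have E : 'X^(k.+2) %| (log (g j.+1) - log (g j)) - m%:R * (log (delta j.+1) - log (delta j)).
    have h1 := series_logM charF0 k.+1 (path_value_at0 j.+1)
      (_ : (delta j ^+ m).[0] = 1).
    have h2 := series_logM charF0 k.+1 (path_value_at0 j) (_ : (delta j.+1 ^+ m).[0] = 1).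
    have X1 l : (delta l ^+ m).[0] = 1 by rewrite horner_exp delta_at0 expr1n.
    have {h1} h1 := h1 (X1 _); have {h2} h2 := h2 (X1 _).
    have h3 := series_logX charF0 k.+1 m (delta_at0 j).
    have h4 := series_logX charF0 k.+1 m (delta_at0 j.+1).
    rewrite path_value_step in h1.
    have -> : log (g j.+1) - log (g j) - m%:R * (log (delta j.+1) - log (delta j)) =
      (log (g j * delta j.+1 ^+ m) - (log (g j) + log (delta j.+1 ^+ m)))
      - (log (g j * delta j.+1 ^+ m) - (log (g j.+1) + log (delta j ^+ m)))
      + (log (delta j.+1 ^+ m) - m%:R * log (delta j.+1))
      - (log (delta j ^+ m) - m%:R * log (delta j)) by ring.
    by apply: dvdp_sub h3; apply: dvdp_add h4; apply: dvdp_sub h1.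
  have -> : (m%:R^-1)%:P * (log (g j.+1) - log (g j)) - (log (delta j.+1) - log (delta j)) =
    (m%:R^-1)%:P * ((log (g j.+1) - log (g j)) - m%:R * (log (delta j.+1) - log (delta j))).
    by rewrite [RHS]mulrBr mulrA cm mul1r.
  exact: dvdp_mull.
have /dvdp_XnP/(_ k.+1 (leqnn _))/eqP := cong.
by rewrite coefB subr_eq0 => /eqP.
Qed.

End Point.
End ExtractDeterminant.

(** * Border complexity of the determinant *)

Section DetBorderBound.
Variable F : fieldType.
Hypothesis charF0 : [pchar F] =i pred0.

Lemma deg_le_series_log k (g : {poly F}) d :
  deg_le g d -> deg_le (series_log (@polyC F) k g) (k * d).
Proof.
move=> gd; apply: deg_le_sum => i; rewrite -[X in deg_le _ X]add0n.
apply: deg_le_mul (deg_le_const _ _) _.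
apply: (@deg_le_weak _ _ (i.+1 * d)); first by rewrite leq_mul2r ltn_ord orbT.
apply: deg_le_exp; apply: deg_le_add gd _.
by apply: deg_le_opp; apply: (deg_le_const 1).
Qed.

Lemma deg_le_series_exp k (u : {poly F}) d :
  deg_le u d -> deg_le (series_exp (@polyC F) k u) (k * d).
Proof.
move=> ud; apply: deg_le_sum => i; rewrite -[X in deg_le _ X]add0n.
apply: deg_le_mul (deg_le_const _ _) _.
apply: (@deg_le_weak _ _ (i * d)); last exact: deg_le_exp.
by rewrite leq_mul2r -ltnS ltn_ord orbT.
Qed.

(** The degree in [t] fixes the number of interpolation nodes; logarithm and exponential each
    multiply it by at most [k.+1]. *)
Lemma deg_le_det_path n k (mu : 'I_n -> nat) (h : {mpoly F[n * n]}) (kn : (k < n)%N)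
    (x : 'M[F]_k.+1) d : (msize h <= d.+1)%N ->
  deg_le (det_path mu h kn (@polyC F) 'X (map_mx polyC x)) (k.+1 * (k.+1 * d)).
Proof.
move=> hd; have pv j : deg_le (path_value h (@polyC F) 'X (map_mx polyC x) j) d.
  apply: deg_le_mmap hd => i; case/mxvec_indexP: i => a b; rewrite mxvecE !mxE.
  have nd c : deg_le (c%:R : {poly F}) 1 by rewrite -polyC_natr; apply: deg_le_const.
  case: ifP => _ //; apply: deg_le_add => //; rewrite -[X in deg_le _ X]addn0.
  by apply: deg_le_mul (deg_le_const _ _); rewrite /deg_le size_polyX.
apply: deg_le_series_exp; apply: deg_le_sum => j; rewrite -[X in deg_le _ X]add0n.
apply: deg_le_mul (deg_le_const _ _) _; apply: deg_le_add.
  exact: deg_le_series_log.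
by apply: deg_le_opp; apply: deg_le_series_log.
Qed.

Lemma border_le_series_log m k (g : {mpoly F[m]}) S : border_le g S ->
  border_le (series_log (@mpolyC m F) k g) (k * (k * S.+2).+2).
Proof.
move=> gS; apply: border_le_sum => i.
apply: (@border_le_weak _ _ _ (0 + i.+1 * S.+2).+1).
  by rewrite add0n ltnS leq_mul2r ltn_ord orbT.
apply: border_le_mul; first exact: border_le_const.
apply: border_le_exp; rewrite -mpolyC1 -mpolyCN -[S]addn0 -addnS addnS.
by apply: border_le_add => //; apply: border_le_const.
Qed.

Lemma border_le_series_exp m k (u : {mpoly F[m]}) S : border_le u S ->
  border_le (series_exp (@mpolyC m F) k u) (k.+1 * (k * S.+1).+2).
Proof.
move=> uS; apply: border_le_sum => i.
apply: (@border_le_weak _ _ _ (0 + i * S.+1).+1).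
  by rewrite add0n ltnS leq_mul2r -(ltnS i) ltn_ord orbT.
by apply: border_le_mul; [exact: border_le_const | exact: border_le_exp].
Qed.

(** [S3] is an abstract bound on the cost of one logarithm, which keeps the nested sizes
    readable. *)
Lemma border_le_det_path n k (mu : 'I_n -> nat) (h : {mpoly F[n * n]}) (kn : (k < n)%N)
    (tau : F) S S3 : border_le h S ->
  (k.+1 * (k.+1 * (S + S.+1 * 2).+2).+2 <= S3)%N ->
  border_le (det_path mu h kn (@mpolyC _ F) tau%:MP (var_mx F k.+1))
    (k.+2 * (k.+1 * (k.+1 * (S3 + S3.+1).+3).+1).+2).
Proof.
move=> hS hS3.
have pv j : border_le (path_value h (@mpolyC _ F) tau%:MP (var_mx F k.+1) j) (S + S.+1 * 2).
  apply: border_le_comp hS _ => i; case/mxvec_indexP: i => a b; rewrite mxvecE !mxE.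
  have nd c s : border_le (c%:R : {mpoly F[k.+1 * k.+1]}) s.
    apply: (@border_le_weak _ _ _ 0) => //.
    by rewrite -[c%:R](rmorph_nat (@mpolyC _ F)); apply: border_le_const.
  case: ifP => _ //; apply: (@border_le_add _ _ _ _ 0 1) => //.
  by apply: (@border_le_mul _ _ _ _ 0 0); [apply: border_le_const | apply: border_le_var].
have lg j : border_le
    (series_log (@mpolyC _ F) k.+1 (path_value h (@mpolyC _ F) tau%:MP (var_mx F k.+1) j)) S3.
  by apply: border_le_weak hS3 _; apply: border_le_series_log.
apply: border_le_series_exp; apply: border_le_sum => j.
apply: (@border_le_mul _ _ _ _ 0 (S3 + S3.+1).+1); first exact: border_le_const.
apply: border_le_add => //; rewrite -mulN1r -mpolyC1 -mpolyCN.
by apply: (@border_le_mul _ _ _ _ 0 S3) => //; apply: border_le_const.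
Qed.

(** Lagrange interpolation at the nodes 0, ..., [D]: the coefficient of index [k] is a combination
    of values of [G v] with weights [w] independent of [v]. *)
Lemma mpoly_coef_interpolation m (D k : nat) (q : F -> {mpoly F[m]}) (p : {mpoly F[m]})
    (G : ('I_m -> F) -> {poly F}) S :
  (forall v, deg_le (G v) D) -> (forall v tau, (q tau).@[v] = (G v).[tau]) ->
  (forall v, p.@[v] = (G v)`_k) -> (forall tau, border_le (q tau) S) ->
  border_le p (D.+1 * S.+2).
Proof.
move=> GD qG pG qS; pose node (i : nat) : F := i%:R.
have node_inj : injective node by exact: natr_inj_char0.
pose w (i : 'I_D.+1) : F := (tnth (D.+1.-lagrange node) i)`_k.
suff -> : p = \sum_(i < D.+1) (w i)%:MP * q (node i).
  apply: border_le_sum => i; rewrite -[S]add0n.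
  by apply: border_le_mul => //; apply: border_le_const.
apply/eqP; rewrite -subr_eq0; apply/eqP; apply: (mpoly_eq0_points charF0) => v.
rewrite mevalB pG (raddf_sum (meval v)).
have -> : (G v)`_k = \sum_(i < D.+1) (G v).[node i] * w i.
  rewrite {1}(lagrange_gen (isT : (0 < D.+1)%N) node_inj (GD v)) coef_sum.
  by apply: eq_bigr => i _; rewrite coefCM.
rewrite -sumrB big1 // => i _.
by rewrite /= mevalM mevalC qG mulrC subrr.
Qed.

(** Bookkeeping in powers of [W], whose size at least 8 absorbs constants: [W ^ 4] for [h], [W ^ 8]
    for a logarithm, [W ^ 14] for [det_path] at one node, then at most [W ^ 8] nodes of cost at most
    [W ^ 15] each. *)
Lemma border_le_det n r (f : {mpoly F[n * n]}) (phi : formula F (n * n)) W :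
  (r < n)%N -> f != 0 -> formula_eval phi = f ->
  (forall M : 'M[F]_n, (\rank M <= r)%N -> mx_eval idfun M f = 0) ->
  (n <= W)%N -> (formula_size phi <= W)%N -> (8 <= W)%N ->
  border_le (det_poly F r.+1) (W ^ 23).
Proof.
move=> rn f0 phif frank nW sW W8.
have [mu [h [mu0 hS hM]]] := semi_invariant_degeneration charF0 f0 phif frank.
have {}hS : border_le h (W ^ 4).
  apply: border_le_weak hS.
  have e1 : (n * (n * 2).+1 <= 3 * W ^ 2)%N.
    by apply: (@leq_trans (W * (3 * W))); [apply: leq_mul => //; lia | rewrite mulnCA mulnn].
  have e2 : ((formula_size phi).+1 * (n * (n * 2).+1) <= 6 * W ^ 3)%N.
    apply: (@leq_trans ((2 * W) * (3 * W ^ 2))); first by apply: leq_mul => //; lia.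
    by rewrite mulnACA -expnS.
  have e3 : (8 * W ^ 3 <= W ^ 4)%N by rewrite expnS leq_mul2r W8 orbT.
  have e4 : (W <= W ^ 3)%N by rewrite -{1}[W]expn1 leq_exp2l //; lia.
  lia.
set S := (W ^ 4)%N in hS.
have rW : (r.+1 <= W)%N by apply: leq_trans nW.
have step a : (8 * W ^ a <= W ^ a.+1)%N by rewrite expnS leq_mul2r W8 orbT.
have WP a : (0 < W ^ a)%N by rewrite expn_gt0; lia.
have mulW x y a : (x <= W)%N -> (y <= W ^ a)%N -> (x * y <= W ^ a.+1)%N.
  by move=> hx hy; rewrite expnS; apply: leq_mul.
have S2 : ((S + S.+1 * 2).+2 <= W ^ 5)%N by have := step 4; have := WP 4; lia.
have S3 : (r.+1 * (r.+1 * (S + S.+1 * 2).+2).+2 <= W ^ 8)%N.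
  apply: (mulW) => //; have := mulW _ _ 5 rW S2; have := step 6; have := WP 6; lia.
pose c := @mpolyC (r.+1 * r.+1) F.
pose q tau := det_path mu h rn c tau%:MP (var_mx F r.+1).
have qS tau : border_le (q tau) (W ^ 14).
  apply: border_le_weak (border_le_det_path mu rn tau hS S3).
  have S4 : ((r.+1 * (W ^ 8 + (W ^ 8).+1).+3).+1 <= W ^ 11)%N.
    have : ((W ^ 8 + (W ^ 8).+1).+3 <= W ^ 9)%N by have := step 8; have := WP 8; lia.
    by move/(mulW _ _ 9 rW) => h1; have := step 10; have := WP 10; lia.
  have h1 := mulW _ _ 11 rW S4.
  apply: (@leq_trans ((2 * W) * (2 * W ^ 12))).
    by apply: leq_mul; [lia | have := step 11; have := WP 11; lia].
  by rewrite mulnACA -expnS; have := step 13; lia.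
have hd : (msize h <= S.+1.+1)%N by apply: msize_border_le.
pose pt (v : 'I_(r.+1 * r.+1) -> F) : 'M[F]_r.+1 := vec_mx (\row_i v i).
pose G v := det_path mu h rn (@polyC F) 'X (map_mx polyC (pt v)).
have GD v : deg_le (G v) (r.+1 * (r.+1 * S.+1)) by apply: deg_le_det_path.
have qG v tau : (q tau).@[v] = (G v).[tau].
  pose ev : {rmorphism {mpoly F[r.+1 * r.+1]} -> F} := meval v.
  pose hv : {rmorphism {poly F} -> F} := horner_eval tau.
  transitivity (det_path mu h rn idfun tau (pt v)).
    rewrite -[LHS]/(ev (q tau)) rmorph_det_path.
    have -> : ev tau%:MP = tau by exact: mevalC.
    have -> : map_mx ev (var_mx F r.+1) = pt v.
      by apply/matrixP => a b; rewrite !mxE [LHS]mevalXU.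
    by apply: eq_det_path => e; exact: mevalC.
  rewrite -[RHS]/(hv (G v)) rmorph_det_path map_horner_polyC.
  have -> : hv 'X = tau by rewrite /hv /= horner_evalE hornerX.
  by apply: eq_det_path => e; rewrite /= horner_evalE hornerC.
have pG v : (det_poly F r.+1).@[v] = (G v)`_r.+1.
  rewrite (coef_det_path charF0 rn mu0 hM) /det_poly -det_map_mx; congr (\det _).
  by apply/matrixP => a b; rewrite !mxE [LHS]mevalXU.
apply: border_le_weak (mpoly_coef_interpolation GD qG pG qS).
rewrite -[23%N]/(8 + 15)%N expnD; apply: leq_mul.
  have S1 : (S.+1 <= W ^ 5)%N by have := step 4; have := WP 4; rewrite /S; lia.
  have := mulW _ _ 6 rW (mulW _ _ 5 rW S1).
  by have := step 7; have := WP 7; lia.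
by have := step 14; have := WP 14; lia.
Qed.

End DetBorderBound.

(** * Polynomial-time functions in unary *)

Section PolytimeClosure.

Lemma polytime_ext k (f g : k.-tuple bitseq -> bitseq) : f =1 g -> polytime f -> polytime g.
Proof. by move=> /functional_extensionality ->. Qed.

Lemma polytime_comp k l (f : k.-tuple bitseq -> bitseq)
    (gs : k.-tuple (l.-tuple bitseq -> bitseq)) :
  polytime f -> (forall i, polytime (tnth gs i)) ->
  polytime (fun v => f (map_tuple (fun g => g v) gs)).
Proof.
move=> pf pg; apply: polytime_ext (pt_comp pf pg) => v /=; congr f.
by apply: eq_from_tnth => i; rewrite tnth_mktuple tnth_map.
Qed.

Lemma polytime_comp1 l (f : 1.-tuple bitseq -> bitseq) (g : l.-tuple bitseq -> bitseq) :
  polytime f -> polytime g -> polytime (fun v => f [tuple g v]).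
Proof.
move=> pf pg.
apply: polytime_ext (polytime_comp (gs := [tuple g]) pf _) => [v|i].
  by congr f; apply: val_inj.
by rewrite (ord1 i).
Qed.

Lemma polytime_comp2 l (f : 2.-tuple bitseq -> bitseq) (g1 g2 : l.-tuple bitseq -> bitseq) :
  polytime f -> polytime g1 -> polytime g2 -> polytime (fun v => f [tuple g1 v; g2 v]).
Proof.
move=> pf p1 p2.
apply: polytime_ext (polytime_comp (gs := [tuple g1; g2]) pf _) => [v|[[|[|//]] i]] //.
by congr f; apply: val_inj.
Qed.

Lemma polytime_comp3 l (f : 3.-tuple bitseq -> bitseq)
    (g1 g2 g3 : l.-tuple bitseq -> bitseq) :
  polytime f -> polytime g1 -> polytime g2 -> polytime g3 ->
  polytime (fun v => f [tuple g1 v; g2 v; g3 v]).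
Proof.
move=> pf p1 p2 p3.
apply: polytime_ext (polytime_comp (gs := [tuple g1; g2; g3]) pf _) => [v|[[|[|[|//]]] i]] //.
by congr f; apply: val_inj.
Qed.

(* Numbers are handled in unary, so these are the functions computable in time
   polynomial in the values of the arguments. *)
Definition upoly k (a : k.-tuple bitseq -> nat) : Prop := polytime (fun v => unary (a v)).

Definition upoly2 (op : nat -> nat -> nat) : Prop :=
  upoly (fun v : 2.-tuple bitseq => op (size (tnth v ord0)) (size (tnth v ord_max))).

Section Arity.
Variable k : nat.
Implicit Types a b : k.-tuple bitseq -> nat.

Lemma upoly_ext a b : a =1 b -> upoly a -> upoly b.
Proof. by move=> e; apply: polytime_ext => v; rewrite e. Qed.

Lemma upoly0 : upoly (fun _ : k.-tuple bitseq => 0%N).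
Proof. exact: pt_nil. Qed.

Lemma upolyS a : upoly a -> upoly (fun v => (a v).+1).
Proof. by move=> pa; apply: polytime_ext (polytime_comp1 (pt_cons true) pa). Qed.

Lemma upoly_const c : upoly (fun _ : k.-tuple bitseq => c).
Proof. by elim: c => [|c IHc]; [exact: upoly0 | exact: upolyS]. Qed.

Lemma upoly_op2 op a b : upoly2 op -> upoly a -> upoly b -> upoly (fun v => op (a v) (b v)).
Proof.
move=> po pa pb; apply: polytime_ext (polytime_comp2 po pa pb) => v.
by rewrite /= !size_nseq.
Qed.

Lemma upoly2_mul : upoly2 muln.
Proof. exact: pt_smash. Qed.

Lemma upoly_mul a b : upoly a -> upoly b -> upoly (fun v => a v * b v)%N.
Proof. exact: upoly_op2 upoly2_mul. Qed.

(** Smashing with a string of length 1 turns any string into the unary form of its length. *)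
Lemma upoly_size i : upoly (fun v : k.-tuple bitseq => size (tnth v i)).
Proof.
apply: polytime_ext (polytime_comp2 pt_smash (pt_proj i) (upoly_const 1)) => v.
by rewrite /= muln1.
Qed.

Lemma upoly_exp a e : upoly a -> upoly (fun v => a v ^ e)%N.
Proof.
move=> pa; elim: e => [|e IHe]; first exact: (upoly_const 1).
by apply: upoly_ext (upoly_mul pa IHe) => v; rewrite expnS.
Qed.

End Arity.

(** The same step serves both bits, so recursion on notation becomes bounded primitive recursion on
    lengths. *)
Lemma upoly2_rec (g : nat -> nat) (h : nat -> nat -> nat -> nat) (f b : nat -> nat -> nat) :
  upoly (fun v : 1.-tuple bitseq => g (size (tnth v ord0))) ->
  upoly (fun v : 3.-tuple bitseq =>
    h (size (tnth v ord0)) (size (tnth v (inord 1))) (size (tnth v ord_max))) ->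
  upoly2 b -> (forall y, f 0%N y = g y) -> (forall x y, f x.+1 y = h x (f x y) y) ->
  (forall x y, f x y <= b x y)%N -> upoly2 f.
Proof.
move=> pg ph pb f0 fS fb.
have i1 : inord 1 = Ordinal (isT : (1 < 3)%N) by apply: val_inj; rewrite /= inordK.
apply: (pt_rec (h := fun _ => _) pg (fun _ => ph) pb) => [v|c w v|v].
- by case/tupleP: v => y v; rewrite /= f0.
- case/tupleP: v => y v; rewrite /= fS i1 /= size_nseq.
  by rewrite /tnth /=.
- by rewrite !size_nseq.
Qed.

(** Addition comes after multiplication because the recursion rule asks for a bound already known to
    be computable, here [(x + 1) * (y + 1)]. *)
Lemma upoly2_add : upoly2 addn.
Proof.
apply: (@upoly2_rec id (fun _ r _ => r.+1) _ (fun x y => x.+1 * y.+1)%N) => // [|||x y].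
- exact: upoly_size.
- by apply: upolyS; apply: upoly_size.
- by apply: upoly_mul; apply: upolyS; apply: upoly_size.
- by rewrite mulSn mulnS; lia.
Qed.

Lemma upoly2_pred : upoly2 (fun x _ => x.-1).
Proof.
apply: (@upoly2_rec (fun=> 0%N) (fun x _ _ => x) _ (fun x _ => x)) => // [||| x _].
- exact: upoly0.
- exact: upoly_size.
- exact: upoly_size.
- exact: leq_pred.
Qed.

Lemma upoly_pred k (a : k.-tuple bitseq -> nat) : upoly a -> upoly (fun v => (a v).-1).
Proof. by move=> pa; apply: (upoly_op2 upoly2_pred pa pa). Qed.

(** The subtrahend comes first because the recursion runs on the first argument. *)
Lemma upoly2_subr : upoly2 (fun x y => y - x)%N.
Proof.
apply: (@upoly2_rec id (fun _ r _ => r.-1) _ (fun _ y => y)) => // [||||x y|].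
- exact: upoly_size.
- by apply: upoly_pred; apply: upoly_size.
- exact: upoly_size.
- by move=> y; rewrite subn0.
- by rewrite subnS.
- by move=> x y; apply: leq_subr.
Qed.

Section Arith.
Variable k : nat.
Implicit Types a b : k.-tuple bitseq -> nat.

Lemma upoly_add a b : upoly a -> upoly b -> upoly (fun v => a v + b v)%N.
Proof. exact: upoly_op2 upoly2_add. Qed.

Lemma upoly_sub a b : upoly a -> upoly b -> upoly (fun v => a v - b v)%N.
Proof. by move=> pa pb; apply: (upoly_op2 upoly2_subr pb pa). Qed.

Lemma upoly_leq a b : upoly a -> upoly b -> upoly (fun v => (a v <= b v)%N : nat).
Proof.
move=> pa pb; apply: upoly_ext (upoly_sub (upoly_const k 1) (upoly_sub pa pb)) => v.
by rewrite -subn_eq0; case: (a v - b v)%N.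
Qed.

End Arith.

(** The integer part of the [e]-th root for positive [e]. It grows by at most one at each step,
    which makes it an instance of bounded recursion. *)
Fixpoint iroot (e N : nat) : nat :=
  if N is N'.+1 then (iroot e N' + ((iroot e N').+1 ^ e <= N'.+1)%N)%N else 0%N.

Lemma iroot_le e N : (iroot e N <= N)%N.
Proof. by elim: N => //= N IHN; case: (_ ^ _ <= _)%N; lia. Qed.

Lemma upoly_iroot k e (a : k.-tuple bitseq -> nat) : upoly a -> upoly (fun v => iroot e (a v)).
Proof.
move=> pa; apply: (upoly_op2 (op := fun x _ => iroot e x) _ pa pa).
apply: (@upoly2_rec (fun=> 0%N) (fun x r _ => r + (r.+1 ^ e <= x.+1)%N)%N _ (fun x _ => x)) => //.
- exact: upoly0.
- apply: upoly_add; first exact: upoly_size.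
  by apply: upoly_leq; [apply: upoly_exp|]; apply: upolyS; apply: upoly_size.
- exact: upoly_size.
- by move=> x _; apply: iroot_le.
Qed.

(** The quotient grows by at most one with the dividend; the factor [0 < y] matches the convention
    that division by zero gives zero. *)
Lemma upoly2_div : upoly2 divn.
Proof.
apply: (@upoly2_rec (fun=> 0%N) (fun x r y => r + (0 < y) * (r.+1 * y <= x.+1)%N)%N _ (fun x _ => x)).
- exact: upoly0.
- apply: upoly_add; first exact: upoly_size.
  apply: upoly_mul; first by apply: upoly_leq; [exact: upoly_const | exact: upoly_size].
  by apply: upoly_leq; [apply: upoly_mul|]; rewrite ?(upolyS, upoly_size) //;
    do ?apply: upolyS; apply: upoly_size.
- exact: upoly_size.
- by move=> y; rewrite div0n.
- move=> x [|y]; first by rewrite !divn0.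
  rewrite mul1n -leq_divRL //.
  have : (x.+1 %/ y.+1 <= (x %/ y.+1).+1)%N by rewrite -ltnS -[X in (_ < X)%N]addn1 ltn_divLR //;
    have := ltn_ceil x (ltn0Sn y); rewrite mulnDl; lia.
  have : (x %/ y.+1 <= x.+1 %/ y.+1)%N by apply: leq_div2r.
  by move: (x %/ y.+1)%N (x.+1 %/ y.+1)%N => u w; case: ltnP; lia.
- by move=> x y; apply: leq_div.
Qed.

Section Arith2.
Variable k : nat.
Implicit Types a b : k.-tuple bitseq -> nat.

Lemma upoly_div a b : upoly a -> upoly b -> upoly (fun v => a v %/ b v)%N.
Proof. exact: upoly_op2 upoly2_div. Qed.

Lemma upoly_mod a b : upoly a -> upoly b -> upoly (fun v => a v %% b v)%N.
Proof.
move=> pa pb; apply: upoly_ext (upoly_sub pa (upoly_mul (upoly_div pa pb) pb)) => v.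
by rewrite {1}(divn_eq (a v) (b v)) addKn.
Qed.

End Arith2.

Lemma polytime_cat2 : polytime (fun v : 2.-tuple bitseq => tnth v ord0 ++ tnth v ord_max).
Proof.
have ph c : polytime (fun v : 3.-tuple bitseq => c :: tnth v (inord 1)).
  exact: polytime_ext (polytime_comp1 (pt_cons c) (pt_proj (inord 1))).
have i1 : inord 1 = Ordinal (isT : (1 < 3)%N) by apply: val_inj; rewrite /= inordK.
apply: (pt_rec (pt_proj ord0) ph upoly2_add) => [v|c w v|v].
- by case/tupleP: v => y v.
- by case/tupleP: v => y v; rewrite i1.
- by rewrite size_nseq size_cat.
Qed.

Section Strings.
Variable k : nat.
Implicit Types (a : k.-tuple bitseq -> nat) (s t : k.-tuple bitseq -> bitseq).

Lemma polytime_cat s t : polytime s -> polytime t -> polytime (fun v => s v ++ t v).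
Proof. by move=> ps pt; apply: polytime_ext (polytime_comp2 polytime_cat2 ps pt). Qed.

(** A recursion on the condition whose step discards the recursive value; the concatenation of the
    branches bounds the result. *)
Lemma polytime_if a s t : upoly a -> polytime s -> polytime t ->
  polytime (fun v => if a v is 0 then t v else s v).
Proof.
move=> pa ps pt.
pose f (v : 3.-tuple bitseq) :=
  if tnth v ord0 is [::] then tnth v (inord 2) else tnth v (inord 1).
have pf : polytime f.
  have e1 : inord 1 = Ordinal (isT : (1 < 2)%N) by apply: val_inj; rewrite /= inordK.
  have e2 : inord 2 = Ordinal (isT : (2 < 4)%N) by apply: val_inj; rewrite /= inordK.
  have e3 : inord 1 = Ordinal (isT : (1 < 3)%N) by apply: val_inj; rewrite /= inordK.
  have e4 : inord 2 = Ordinal (isT : (2 < 3)%N) by apply: val_inj; rewrite /= inordK.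
  have pb : polytime (fun v : 3.-tuple bitseq => tnth v (inord 1) ++ tnth v (inord 2)).
    exact: polytime_ext (polytime_comp2 polytime_cat2 (pt_proj (inord 1)) (pt_proj (inord 2))).
  apply: (pt_rec (pt_proj (inord 1)) (fun _ => pt_proj (inord 2)) pb) => [v|c w v|v].
  - by rewrite /f e1 e4; case/tupleP: v => x v; case/tupleP: v => y v.
  - by rewrite /f e2 e3; case/tupleP: v => x v; case/tupleP: v => y v.
  - by rewrite /f size_cat; case: (tnth v ord0) => [|_ _]; rewrite ?leq_addl ?leq_addr.
apply: polytime_ext (polytime_comp3 pf pa ps pt) => v.
rewrite /f /= !(tnth_nth [::]) /= !inordK //=.
by case: (a v).
Qed.

Lemma polytime_tokens (ks : seq (k.-tuple bitseq -> nat)) :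
  foldr (fun a p => upoly a /\ p) True ks ->
  polytime (fun v => flatten [seq rcons (unary (a v)) false | a <- ks]).
Proof.
elim: ks => [|a ks IHks] /= => [_|[pa pks]]; first exact: pt_nil.
apply: polytime_cat; last exact: IHks.
have pF : polytime (fun _ : k.-tuple bitseq => [:: false]).
  exact: polytime_ext (polytime_comp1 (pt_cons false) (pt_nil k)).
by apply: polytime_ext (polytime_cat pa pF) => v; rewrite cats1.
Qed.

End Strings.
End PolytimeClosure.

(** * The generator *)

Lemma iroot_exp_le e N : (0 < e)%N -> (iroot e N ^ e <= N)%N.
Proof.
move=> e0; elim: N => [|N IHN] /=; first by rewrite exp0n.
case: (boolP ((iroot e N).+1 ^ e <= N.+1)%N) => h /=; rewrite ?addn1 ?addn0 //.
exact: leqW.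
Qed.

Lemma iroot_lt_exp e N : (0 < e)%N -> (N < (iroot e N).+1 ^ e)%N.
Proof.
move=> e0; elim: N => [|N IHN] /=; first by rewrite expn_gt0.
case: (leqP ((iroot e N).+1 ^ e) N.+1) => h /=; rewrite ?addn1 ?addn0 //.
by apply: leq_ltn_trans IHN _; rewrite ltn_exp2r.
Qed.

Section Generator.
(* Output i = b + k n^2 with b = p n + q and k < r is the share
   y_(k,p) z_(k,q) + rho_(i - n^2) - rho_i of the (p, q) entry of a matrix of rank at
   most r; the first layer has no rho_(i - n^2), the last one no rho_i, and the outputs
   i >= r n^2 are the variables rho_(i - n^2). *)
Variables (r n : nat).

Definition share_on (i : nat) : bool := (i < r * n ^ 2)%N.
Definition prev_on (i : nat) : bool := (n ^ 2 <= i)%N.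
Definition next_on (i : nat) : bool := (i < r.-1 * n ^ 2)%N.

(* The index of an inactive term is 0, so that it is always a seed position. *)
Definition left_index (i : nat) : nat := (share_on i * (i %/ n))%N.
Definition right_index (i : nat) : nat :=
  (share_on i * (r * n + (i %/ n ^ 2) * n + i %% n))%N.
Definition prev_index (i : nat) : nat := (prev_on i * (2 * r * n + (i - n ^ 2)))%N.
Definition next_index (i : nat) : nat := (next_on i * (2 * r * n + i))%N.

(** [2 r n] coordinates for [y] and [z], [(r - 1) n^2] masks, and [M - r n^2] free outputs. *)
Definition seed_size (M : nat) : nat := (2 * r * n + M - n ^ 2)%N.

Variable l : nat.

Definition seed_gate (T : Type) (j : nat) (d : T) : gate T l :=
  if insub j is Some o then GVar T o else GConst l d.

(** The shape is the same for all [i]: inactive terms are multiplied by the constant 0. This keeps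
    six internal gates and a code with a fixed number of tokens. *)
Definition share_circuit (i : nat) : circuit rat l :=
  [:: seed_gate (left_index i) 0; seed_gate (right_index i) 0;
      seed_gate (prev_index i) 0; seed_gate (next_index i) 0;
      GConst l (share_on i)%:R; GConst l (prev_on i)%:R; GConst l (- (next_on i)%:R);
      GMul _ _ 0 1; GMul _ _ 4 7; GMul _ _ 5 2; GMul _ _ 6 3; GAdd _ _ 8 9; GAdd _ _ 11 10].

Lemma index_lt M i : (0 < r)%N -> (0 < n)%N -> (r * n ^ 2 <= M)%N -> (i < M)%N ->
  [/\ (left_index i < seed_size M)%N, (right_index i < seed_size M)%N,
      (prev_index i < seed_size M)%N & (next_index i < seed_size M)%N].
Proof.
move=> r0 n0 rM iM.
have n2 : (n ^ 2 <= M)%N by apply: leq_trans rM; rewrite leq_pmull.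
have pos : (0 < seed_size M)%N.
  rewrite /seed_size -addnBA // addn_gt0 !muln_gt0 r0 n0 //.
have sE : seed_size M = (2 * r * n + (M - n ^ 2))%N by rewrite /seed_size addnBA.
rewrite /left_index /right_index /prev_index /next_index /share_on /prev_on /next_on.
split.
- case: (ltnP i (r * n ^ 2)) => h; rewrite ?mul0n ?mul1n //.
  have : (i %/ n < r * n)%N by rewrite ltn_divLR // -mulnA mulnn.
  by rewrite sE; lia.
- case: (ltnP i (r * n ^ 2)) => h; rewrite ?mul0n ?mul1n //.
  have h1 : (i %/ n ^ 2 < r)%N by rewrite ltn_divLR // expn_gt0 n0.
  have h2 : (i %% n < n)%N by rewrite ltn_mod.
  have h3 : ((i %/ n ^ 2).+1 * n <= r * n)%N by rewrite leq_mul2r h1 orbT.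
  by move: h3; rewrite sE mulSn; lia.
- case: (leqP (n ^ 2) i) => h; rewrite ?mul0n ?mul1n //.
  by rewrite sE; lia.
- case: (ltnP i (r.-1 * n ^ 2)) => h; rewrite ?mul0n ?mul1n //.
  have h1 : (i + n ^ 2 < M)%N.
    by apply: leq_trans rM; rewrite -(prednK r0) mulSn addnC ltn_add2l.
  by rewrite sE; lia.
Qed.

End Generator.

Section GeneratorValue.
Variables (F : fieldType) (r n l : nat).

Definition share_coord (i : nat) : {mpoly F[l]} :=
  circuit_eval (map (gate_map (@ratr F) (m := l)) (share_circuit r n l i)).

Lemma share_circuit_size i :
  circuit_size (map (gate_map (@ratr F) (m := l)) (share_circuit r n l i)) = 6.
Proof. by rewrite /circuit_size /= /seed_gate; do 4!case: insub => [?|] /=. Qed.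

Lemma share_circuit_computes i :
  circuit_computes (map (gate_map (@ratr F) (m := l)) (share_circuit r n l i)) (share_coord i).
Proof. by split=> //; rewrite /circuit_wf /= /seed_gate; do 4!case: insub => [?|] /=. Qed.

Definition seed_var (j : nat) : {mpoly F[l]} := if insub j is Some o then 'X_o else 0.

Lemma ratr_bool (b : bool) : ratr (b%:R : rat) = b%:R :> F.
Proof. exact: ratr_nat. Qed.

Lemma share_coordE i : share_coord i =
  ((share_on r n i)%:R)%:MP * (seed_var (left_index r n i) * seed_var (right_index r n i))
  + ((prev_on n i)%:R)%:MP * seed_var (prev_index r n i)
  + (- (next_on r n i)%:R)%:MP * seed_var (next_index r n i).
Proof.
have gE j : gate_eval [::] (gate_map (@ratr F) (seed_gate l j (0 : rat))) = seed_var j.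
  by rewrite /seed_gate /seed_var; case: insub => //=; rewrite (ratr_nat F 0).
have gV vs j : gate_eval vs (gate_map (@ratr F) (seed_gate l j (0 : rat))) = seed_var j.
  by rewrite -gE /seed_gate; case: insub.
have ratrN (b : bool) : ratr (- b%:R : rat) = - b%:R :> F.
  by case: b; rewrite ?oppr0 ?(ratr_nat F 0) //; have := ratr_int F (-1); rewrite !mulrN1z.
rewrite /share_coord /circuit_eval /share_circuit [map _ _]/= [foldl _ _ _]/= !gV /=.
by rewrite !ratr_bool ratrN addrC addrA.
Qed.

Lemma msize_share_coord i : (msize (share_coord i) <= 8)%N.
Proof.
pose fv j : formula F l := if insub j is Some o then FVar F o else FConst l 0.
have fvE j : formula_eval (fv j) = seed_var j.
  by rewrite /fv /seed_var; case: insub => //=; rewrite mpolyC0.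
have fvS j : formula_size (fv j) = 0%N by rewrite /fv; case: insub.
pose phi := FAdd (FAdd (FMul (FConst l (share_on r n i)%:R)
    (FMul (fv (left_index r n i)) (fv (right_index r n i))))
  (FMul (FConst l (prev_on n i)%:R) (fv (prev_index r n i))))
  (FMul (FConst l (- (next_on r n i)%:R)) (fv (next_index r n i))).
have := msize_formula_eval phi; rewrite /= !fvE !fvS share_coordE.
by apply: leq_trans.
Qed.

Definition seed_val (v : 'I_l -> F) (j : nat) : F := if insub j is Some o then v o else 0.

Lemma share_coord_val v i : (share_coord i).@[v] =
  (share_on r n i)%:R * (seed_val v (left_index r n i) * seed_val v (right_index r n i))
  + (prev_on n i)%:R * seed_val v (prev_index r n i)
  - (next_on r n i)%:R * seed_val v (next_index r n i).
Proof.
have e j : (seed_var j).@[v] = seed_val v j.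
  by rewrite /seed_var /seed_val; case: insub => [o|]; rewrite ?mevalXU ?meval0.
by rewrite share_coordE !mevalD !mevalM !mevalC !e mulNr.
Qed.

End GeneratorValue.

(** The factorization through bases of the column and row spaces, padded by zeros up to [r]
    terms. *)
Lemma rank_le_factor (F : fieldType) n r (X : 'M[F]_n) : (\rank X <= r)%N ->
  exists Y Z : nat -> 'I_n -> F,
    forall p q, X p q = \sum_(0 <= k < r) Y k p * Z k q.
Proof.
move=> Xr.
pose Y k p : F := if insub k is Some o then col_base X p o else 0.
pose Z k q : F := if insub k is Some o then row_base X o q else 0.
exists Y, Z => p q; rewrite -{1}(mulmx_base X) mxE.
rewrite (@big_cat_nat _ _ _ (\rank X)) //= [X in _ + X]big_nat_cond [X in _ + X]big1.
  rewrite addr0 big_mkord; apply: eq_bigr => k _.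
  by rewrite /Y /Z valK.
move=> k /andP[/andP[kr _] _]; rewrite /Y insubF ?mul0r //.
by rewrite ltnNge kr.
Qed.

(** * From a polynomial vanishing on the generator to one vanishing in low rank *)

Section Reduction.
Variable F : fieldType.
Hypothesis charF0 : [pchar F] =i pred0.
Variables (r n' M l : nat).
Local Notation n := n'.+1.
Hypothesis r_gt0 : (0 < r)%N.
Hypothesis rM : (r * n ^ 2 <= M)%N.
Hypothesis Ml : (seed_size r n M <= l)%N.

Let n2_gt0 : (0 < n ^ 2)%N. Proof. by rewrite expn_gt0. Qed.

(** The mask after layer [k] is the sum [S] of the discrepancies [D] between products and prescribed
    shares in the layers up to [k]. By hypothesis the total over all layers is zero, as the last
    layer has no outgoing mask. *)
Lemma share_preimage (Y Z : nat -> 'I_n -> F) (w : nat -> F) :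
  (forall b, (b < n ^ 2)%N -> \sum_(0 <= k < r) w (b + k * n ^ 2)%N =
     \sum_(0 <= k < r) Y k (inord (b %/ n)) * Z k (inord (b %% n))) ->
  exists v : 'I_l -> F, forall i, (i < M)%N -> (share_coord F r n l i).@[v] = w i.
Proof.
move=> hw.
pose prod j := Y (j %/ n ^ 2)%N (inord ((j %/ n) %% n)) * Z (j %/ n ^ 2)%N (inord (j %% n)).
pose D j := prod j - w j.
pose S k b := \sum_(0 <= m < k) D (b + m * n ^ 2)%N.
(* Beyond the masks, [rho] stores the free outputs, shifted by [n ^ 2]. *)
pose rho j := if (j < r.-1 * n ^ 2)%N then S (j %/ n ^ 2).+1 (j %% n ^ 2)%N else w (j + n ^ 2)%N.
pose sv j := if (j < r * n)%N then Y (j %/ n)%N (inord (j %% n))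
  else if (j < 2 * r * n)%N then Z ((j - r * n) %/ n)%N (inord ((j - r * n) %% n))
  else rho (j - 2 * r * n)%N.
have Sr b : (b < n ^ 2)%N -> S r b = 0.
  move=> bn; rewrite /S /D sumrB hw // -sumrB big1_seq // => k _.
  have e1 : ((b + k * n ^ 2) %/ n ^ 2 = k)%N by rewrite divnDMl // divn_small.
  have bE : (b + k * n ^ 2 = k * n * n + b)%N by rewrite addnC -mulnA mulnn.
  have e2 : ((b + k * n ^ 2) %/ n %% n = b %/ n)%N.
    by rewrite bE divnMDl // modnMDl modn_small // ltn_divLR // mulnn.
  have e3 : ((b + k * n ^ 2) %% n = b %% n)%N by rewrite bE modnMDl.
  by rewrite /prod e1 e2 e3 subrr.
exists (fun o => sv o) => i iM; rewrite share_coord_val.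
have sE j : (j < seed_size r n M)%N -> seed_val (fun o : 'I_l => sv o) j = sv j.
  by move=> jl; rewrite /seed_val insubT //; apply: leq_trans Ml.
have [lt0 lt1 lt2 lt3] := index_lt r_gt0 (ltn0Sn n') rM iM.
rewrite !sE // /left_index /right_index /prev_index /next_index.
have svR j : sv (2 * r * n + j)%N = rho j.
  by rewrite /sv !ifF ?addKn //; apply/negbTE; rewrite -leqNgt; lia.
have iE : i = (i %% n ^ 2 + (i %/ n ^ 2) * n ^ 2)%N by rewrite addnC -divn_eq.
have im : (i %% n ^ 2 < n ^ 2)%N by rewrite ltn_mod.
case: (ltnP i (r * n ^ 2)) => [ir|ri]; last first.
  have -> : share_on r n i = false by rewrite /share_on ltnNge ri.
  have -> : prev_on n i by apply: leq_trans ri; rewrite leq_pmull.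
  have -> : next_on r n i = false.
    by apply/negbTE; rewrite /next_on -leqNgt; apply: leq_trans ri; rewrite leq_mul2r leq_pred orbT.
  have ni : (n ^ 2 <= i)%N by apply: leq_trans ri; rewrite leq_pmull.
  rewrite !mul0r add0r mul1n mul1r subr0 svR /rho ifF ?subnK //.
  apply/negbTE; rewrite -leqNgt leq_subRL //.
  by apply: leq_trans ri; rewrite -{2}(prednK r_gt0) mulSn.
have ik : (i %/ n ^ 2 < r)%N by rewrite ltn_divLR.
have onE : share_on r n i = true by [].
have prodE : sv (i %/ n)%N * sv (r * n + (i %/ n ^ 2) * n + i %% n)%N = prod i.
  rewrite /sv /prod.
  have -> : (i %/ n < r * n)%N by rewrite ltn_divLR // -mulnA mulnn.
  have imn : (i %% n < n)%N by rewrite ltn_mod.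
  have kn : ((i %/ n ^ 2).+1 * n <= r * n)%N by rewrite leq_mul2r ik orbT.
  rewrite ifF; last by apply/negbTE; rewrite -leqNgt -addnA leq_addr.
  rewrite ifT; last by move: kn; rewrite mulSn; lia.
  rewrite -addnA addKn divnMDl // modnMDl modn_mod (divn_small imn) addn0.
  by rewrite -divnMA mulnn.
have prevE : (prev_on n i)%:R * sv (prev_on n i * (2 * r * n + (i - n ^ 2)))%N =
    S (i %/ n ^ 2)%N (i %% n ^ 2)%N.
  rewrite /prev_on; case: (leqP (n ^ 2) i) => h; last first.
    by rewrite /= mul0r /S divn_small // big_geq.
  rewrite /= mul1r mul1n svR /rho ifT.
    have -> : ((i - n ^ 2) %/ n ^ 2).+1 = (i %/ n ^ 2)%N.
      by rewrite -{2}(subnK h) divnDr ?dvdnn // divnn n2_gt0 addn1.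
    by have -> // : ((i - n ^ 2) %% n ^ 2 = i %% n ^ 2)%N by rewrite -{2}(subnK h) modnDr.
  by rewrite ltn_subLR // -mulSn prednK.
have nextE : (next_on r n i)%:R * sv (next_on r n i * (2 * r * n + i))%N =
    S (i %/ n ^ 2).+1%N (i %% n ^ 2)%N.
  rewrite /next_on; case: (ltnP i (r.-1 * n ^ 2)) => h /=; first by rewrite mul1r mul1n svR /rho h.
  rewrite mul0r; have -> : (i %/ n ^ 2).+1 = r; last by rewrite Sr.
  apply/eqP; rewrite eqn_leq ik -(prednK r_gt0) ltnS leq_divRL //.
rewrite onE mul1r !mul1n prodE prevE nextE /S big_nat_recr //=.
by rewrite -iE /D; ring.
Qed.

(** All shares outside layer 0 are frozen at a point where [f] is nonzero, and layer 0 is set so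
    that the shares add up to [X]. The matrix [X0] of share sums recovers that point, so [f'] is
    nonzero; in rank at most [r] the shares have a seed, so [f'] vanishes. *)
Lemma share_generator_reduction (G : M.-tuple {mpoly F[l]}) (f : {mpoly F[M]})
    (phi : formula F M) :
  (forall i : 'I_M, tnth G i = share_coord F r n l i) ->
  f != 0 -> comp_mpoly G f = 0 -> formula_eval phi = f ->
  exists (f' : {mpoly F[n * n]}) (phi' : formula F (n * n)),
  [/\ formula_eval phi' = f', (formula_size phi' <= 2 * formula_size phi + 1)%N,
      f' != 0 & forall X : 'M[F]_n, (\rank X <= r)%N -> mx_eval idfun X f' = 0].
Proof.
move=> GE f0 fG phif; have [w0 fw0] := mpoly_neq0_point charF0 f0.
pose t := seed_val w0.
have tE (i : 'I_M) : t i = w0 i by rewrite /t /seed_val valK.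
pose T b := \sum_(1 <= k < r) t (b + k * n ^ 2)%N.
pose wn (X : 'M[F]_n) j :=
  if (j < n ^ 2)%N then X (inord (j %/ n)) (inord (j %% n)) - T j else t j.
pose s (i : 'I_M) : formula F (n * n) :=
  if (i < n ^ 2)%N
  then FAdd (FVar F (mxvec_index (inord (i %/ n)) (inord (i %% n)))) (FConst _ (- T i))
  else FConst _ (t i).
pose phi' := formula_subst s phi.
have f'E X : mx_eval idfun X (formula_eval phi') = f.@[fun i => wn X i].
  pose g : {rmorphism {mpoly F[n * n]} -> F} := mmap idfun (mxvec X 0).
  rewrite -[LHS]/(g _) eval_formula_subst phif rmorph_mmap.
  apply: eq_mmap => [c|i]; first exact: mmapC.
  rewrite /= /s /wn; case: ifP => _ /=; last exact: mmapC.
  rewrite -[mmap _ _ _]/(g _) rmorphD; congr (_ + _); last exact: mmapC.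
  by rewrite [LHS]mmapX mmap1U mxvecE.
exists (formula_eval phi'), phi'; split=> //.
- have sS i : (formula_size (s i) <= 1)%N by rewrite /s; case: ifP.
  by apply: leq_trans (size_formula_subst _ sS) _; lia.
- pose X0 : 'M[F]_n := \matrix_(p, q) \sum_(0 <= k < r) t (p * n + q + k * n ^ 2)%N.
  apply: contra_neq fw0 => z; have := f'E X0; rewrite z /mx_eval mmap0 => ->.
  apply: meval_eq => i; rewrite /wn; case: ltnP => h; last by rewrite tE.
  have p1 : (i %/ n < n)%N by rewrite ltn_divLR // mulnn.
  rewrite mxE !inordK ?ltn_mod // -divn_eq big_ltn // mul0n addn0.
  by rewrite /T tE addrK.
- move=> X /rank_le_factor[Y [Z XE]].
  have hw b : (b < n ^ 2)%N -> \sum_(0 <= k < r) wn X (b + k * n ^ 2)%N =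
     \sum_(0 <= k < r) Y k (inord (b %/ n)) * Z k (inord (b %% n)).
    move=> bn; rewrite -XE big_ltn // mul0n addn0 {1}/wn bn.
    suff -> : \sum_(1 <= k < r) wn X (b + k * n ^ 2)%N = T b by rewrite subrK.
    apply: eq_big_nat => k /andP[k1 _]; rewrite /wn ifF //.
    by apply/negbTE; rewrite -leqNgt (leq_trans _ (leq_addl _ _)) // leq_pmull.
  have [v vE] := share_preimage hw.
  rewrite f'E -[RHS](meval0 v) -fG comp_mpoly_meval.
  by apply: meval_eq => i; rewrite GE vE.
Qed.

End Reduction.

(** With [n = r ^ a], the threshold on [r] makes [n^2 = r * r^(2a-1)] pay for [(2 r)^(2a-1)] and for
    [2 r n <= 2 r^(2a-1)]; the last inequality uses [a >= 2]. *)
Lemma seed_size_root_bound a M (r := iroot a.*2.+1 M) : (2 <= a)%N ->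
  (2 ^ (a.*2.-1) + 2 <= r)%N ->
  (seed_size r (r ^ a) M + (2 * r) ^ a.*2.-1 <= M)%N /\ (r * (r ^ a) ^ 2 <= M)%N.
Proof.
move=> a2 hr.
have r0 : (0 < r)%N by lia.
have e : (a.*2.+1 = a * 2 + 1)%N by lia.
have rM : (r * (r ^ a) ^ 2 <= M)%N.
  by rewrite -expnM -expnS -addn1 -e; apply: iroot_exp_le.
split=> //.
have n2 : ((r ^ a) ^ 2 = r * r ^ a.*2.-1)%N.
  by rewrite -expnM -expnS; congr (_ ^ _)%N; lia.
have rr : (r * r ^ a <= r ^ a.*2.-1)%N by rewrite -expnS leq_exp2l; [lia | lia].
have h1 : (2 * r * r ^ a + (2 * r) ^ a.*2.-1 <= (r ^ a) ^ 2)%N.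
  rewrite n2 expnMn -mulnA.
  apply: (@leq_trans ((2 ^ a.*2.-1 + 2) * r ^ a.*2.-1)); last by rewrite leq_mul2r hr orbT.
  by rewrite mulnDl addnC leq_add2l leq_mul2l rr orbT.
have h2 : ((r ^ a) ^ 2 <= M)%N by apply: leq_trans rM; rewrite leq_pmull.
by rewrite /seed_size; lia.
Qed.

(** * Seed length and choice of exponents *)

Import Num.Theory.

(** Since [M < (r + 1)^(2a+1) <= (2 r)^(2a+1)] and [(2a+1) eps >= 2], the power [M^(1 - eps)] is at
    most [(2 r)^(2a-1)], the saving already established. For [eps >= 1] it is at most 1. *)
Lemma seed_size_le_seed_length (R : realType) (eps : R) a M (r := iroot a.*2.+1 M) :
  2 <= a.*2.+1%:R * eps -> (2 <= a)%N -> (2 ^ (a.*2.-1) + 2 <= r)%N ->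
  (seed_size r (r ^ a) M <= seed_length eps M)%N.
Proof.
move=> ea a2 hr; have [hM _] := seed_size_root_bound a2 hr.
rewrite -/r in hM.
have r0 : (0 < r)%N by lia.
pose B : R := (2 * r)%:R.
have B1 : 1 <= B by rewrite ler1n; lia.
have B0 : 0 <= B by rewrite ler0n.
have M1 : 1 <= M%:R :> R.
  by rewrite ler1n; apply: leq_trans (leq_trans (leq_addl _ _) hM); rewrite expn_gt0; lia.
have main : exp.powR M%:R (1 - eps) <= ((2 * r) ^ a.*2.-1)%:R :> R.
  rewrite natrX -/B.
  have [e1|e1] := lerP (1 - eps) 0.
    apply: (@Order.POrderTheory.le_trans _ _ 1); last by apply: exprn_ege1.
    by have := exp.ler_powR M1 e1; rewrite exp.powRr0.
  have MB : M%:R <= B ^+ a.*2.+1.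
    rewrite -natrX ler_nat; apply: ltnW; apply: leq_trans (iroot_lt_exp M (ltn0Sn a.*2)) _.
    by rewrite leq_exp2r // -/r; lia.
  apply: (@Order.POrderTheory.le_trans _ _ (exp.powR (B ^+ a.*2.+1) (1 - eps))).
    apply: exp.ge0_ler_powR; rewrite ?nnegrE ?ler0n ?exprn_ge0 //.
    exact: Order.POrderTheory.ltW.
  rewrite -(exp.powR_mulrn _ B0) -exp.powRrM -(exp.powR_mulrn a.*2.-1 B0).
  apply: exp.ler_powR => //.
  have -> : a.*2.+1%:R = a.*2.-1%:R + 2 :> R by rewrite -natrD; congr (_%:R); lia.
  have : a.*2.+1%:R = a.*2.-1%:R + 2 :> R by rewrite -natrD; congr (_%:R); lia.
  move=> E; rewrite E in ea; lra.
have sub : (seed_size r (r ^ a) M)%:R + exp.powR M%:R (1 - eps) <= M%:R :> R.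
  apply: (@Order.POrderTheory.le_trans _ _ (seed_size r (r ^ a) M + (2 * r) ^ a.*2.-1)%:R).
    by rewrite natrD lerD2l.
  by rewrite ler_nat.
have sub' : (seed_size r (r ^ a) M)%:R <= M%:R - exp.powR M%:R (1 - eps) by lra.
rewrite /seed_length truncn_ge_nat //.
by apply: Order.POrderTheory.le_trans sub'; rewrite ler0n.
Qed.

Lemma exists_root_exponent (R : realType) (eps : R) : 0 < eps ->
  exists2 a : nat, (2 <= a)%N & 2 <= a.*2.+1%:R * eps.
Proof.
move=> e0; exists (Num.truncn (2 / eps)).+2 => //.
have h : 2 / eps < (Num.truncn (2 / eps)).+1%:R.
  by have /andP[] := truncn_itv (divr_ge0 (ler0n R 2) (Order.POrderTheory.ltW e0)).
rewrite -ler_pdivrMr //; apply: Order.POrderTheory.ltW; apply: (Order.POrderTheory.lt_le_trans h).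
by rewrite ler_nat; lia.
Qed.

Definition pow_bounded (u : nat -> nat) : Prop :=
  exists c, forall k, (2 <= k)%N -> (u k <= k ^ c)%N.

Lemma pow_bounded_const c : pow_bounded (fun=> c).
Proof.
exists c => k k2; apply: leq_trans (ltnW (ltn_expl c (isT : 1 < 2)%N)) _.
by case: c => // c; rewrite leq_exp2r.
Qed.

Lemma pow_bounded_id : pow_bounded id.
Proof. by exists 1%N. Qed.

Lemma pow_bounded_add u v :
  pow_bounded u -> pow_bounded v -> pow_bounded (fun k => u k + v k)%N.
Proof.
move=> [c uc] [d vd]; exists (c + d).+1 => k k2; rewrite expnS.
apply: leq_trans (leq_mul k2 (leqnn _)); rewrite mul2n -addnn; apply: leq_add.
  by apply: leq_trans (uc k k2) _; rewrite leq_exp2l // leq_addr.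
by apply: leq_trans (vd k k2) _; rewrite leq_exp2l // leq_addl.
Qed.

Lemma pow_bounded_exp u d : pow_bounded u -> pow_bounded (fun k => u k ^ d)%N.
Proof.
move=> [c uc]; exists (c * d)%N => k k2; rewrite expnM.
by case: d => // d; rewrite leq_exp2r // uc.
Qed.

(** * Uniformity and constant size of the generator *)

Section ExplicitGenerator.
Variables (a r0 : nat).
Local Notation root M := (iroot a.*2.+1 M).

(** Below the threshold [r0], where the seed need not fit, every output is zero; this concerns only
    small [M]. *)
Definition generator_circuit l M i : circuit rat l :=
  if (r0 <= root M)%N then share_circuit (root M) (root M ^ a) l i
  else [:: GConst l 0].

Definition circuit_generator (F : fieldType) (l : nat -> nat) : polymaps F l :=
  fun M => [tuple circuit_eval (map (gate_map (@ratr F) (m := l M)) (generator_circuit (l M) M i))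
           | i < M].

(** The code of [share_circuit], gate by gate. A constant is tag 1, sign, numerator, denominator;
    the sign of [- on2] is [on2] itself. *)
Definition generator_tokens : seq (2.-tuple bitseq -> nat) :=
  let M (v : 2.-tuple bitseq) := size (tnth v ord0) in
  let i (v : 2.-tuple bitseq) := size (tnth v ord_max) in
  let r v := root (M v) in let n v := (r v ^ a)%N in
  let c k := fun _ : 2.-tuple bitseq => k%N in
  let on0 v : nat := share_on (r v) (n v) (i v) in
  let on1 v : nat := prev_on (n v) (i v) in
  let on2 v : nat := next_on (r v) (n v) (i v) in
  [:: c 0; fun v => left_index (r v) (n v) (i v); c 0; fun v => right_index (r v) (n v) (i v);
      c 0; fun v => prev_index (r v) (n v) (i v); c 0; fun v => next_index (r v) (n v) (i v);
      c 1; c 0; on0; c 1; c 1; c 0; on1; c 1; c 1; on2; on2; c 1;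
      c 3; c 0; c 1; c 3; c 4; c 7; c 3; c 5; c 2; c 3; c 6; c 3; c 2; c 8; c 9; c 2; c 11; c 10].

Lemma upoly_generator_tokens : foldr (fun t p => upoly t /\ p) True generator_tokens.
Proof.
pose M (v : 2.-tuple bitseq) := size (tnth v ord0).
pose i (v : 2.-tuple bitseq) := size (tnth v ord_max).
have pM : upoly M by apply: upoly_size.
have pi : upoly i by apply: upoly_size.
have pr : upoly (fun v => root (M v)) by apply: upoly_iroot.
have pn : upoly (fun v => root (M v) ^ a)%N by apply: upoly_exp.
have pn2 : upoly (fun v => (root (M v) ^ a) ^ 2)%N by apply: upoly_exp.
have on0 : upoly (fun v => share_on (root (M v)) (root (M v) ^ a) (i v) : nat).
  by apply: upoly_leq; [apply: upolyS | apply: upoly_mul].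
have on1 : upoly (fun v => prev_on (root (M v) ^ a) (i v) : nat) by apply: upoly_leq.
have on2 : upoly (fun v => next_on (root (M v)) (root (M v) ^ a) (i v) : nat).
  by apply: upoly_leq; [apply: upolyS | apply: upoly_mul => //; apply: upoly_pred].
have p2rn : upoly (fun v => 2 * root (M v) * root (M v) ^ a)%N.
  by do 2!apply: upoly_mul => //; apply: upoly_const.
have x0 : upoly (fun v => left_index (root (M v)) (root (M v) ^ a) (i v)).
  by apply: upoly_mul => //; apply: upoly_div.
have x1 : upoly (fun v => right_index (root (M v)) (root (M v) ^ a) (i v)).
  apply: upoly_mul => //; apply: upoly_add; last exact: upoly_mod.
  by apply: upoly_add; apply: upoly_mul => //; apply: upoly_div.
have x2 : upoly (fun v => prev_index (root (M v)) (root (M v) ^ a) (i v)).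
  by apply: upoly_mul => //; apply: upoly_add => //; apply: upoly_sub.
have x3 : upoly (fun v => next_index (root (M v)) (root (M v) ^ a) (i v)).
  by apply: upoly_mul => //; apply: upoly_add.
by do ![split; first by [exact: upoly_const | assumption]].
Qed.

Lemma gate_code_seed l j : (j < l)%N -> gate_code (seed_gate l j (0 : rat)) = [:: 0; j]%N.
Proof. by move=> jl; rewrite /seed_gate insubT. Qed.

Variable l : nat -> nat.
Hypothesis r0_gt0 : (0 < r0)%N.
Hypothesis seed_le : forall M, (r0 <= root M)%N ->
  (root M * (root M ^ a) ^ 2 <= M)%N /\ (seed_size (root M) (root M ^ a) M <= l M)%N.

Lemma tnth_circuit_generator (F : fieldType) M (i : 'I_M) :
  tnth (circuit_generator F l M) i =
  circuit_eval (map (gate_map (@ratr F) (m := l M)) (generator_circuit (l M) M i)).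
Proof. by rewrite tnth_mktuple. Qed.

Lemma generator_circuit_computes (F : fieldType) M (i : 'I_M) :
  circuit_computes (map (gate_map (@ratr F) (m := l M)) (generator_circuit (l M) M i))
    (tnth (circuit_generator F l M) i).
Proof.
rewrite tnth_circuit_generator /generator_circuit.
by case: leqP => _; first exact: share_circuit_computes.
Qed.

Lemma explicit_circuit_generator (F : fieldType) : explicit (circuit_generator F l).
Proof.
pose code1 (v : 2.-tuple bitseq) :=
  flatten [seq rcons (unary (t v)) false | t : 2.-tuple bitseq -> nat <- generator_tokens].
pose tokens0 : seq (2.-tuple bitseq -> nat) := [:: fun=> 1; fun=> 0; fun=> 0; fun=> 1]%N.
pose code0 (v : 2.-tuple bitseq) :=
  flatten [seq rcons (unary (t v)) false | t : 2.-tuple bitseq -> nat <- tokens0].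
pose on (v : 2.-tuple bitseq) : nat := (r0 <= root (size (tnth v ord0)))%N.
exists (fun v => if on v is 0 then code0 v else code1 v).
  apply: polytime_if.
  - apply: upoly_leq; first exact: upoly_const.
    by apply: upoly_iroot; apply: upoly_size.
  - by apply: polytime_tokens; apply: upoly_generator_tokens.
  - by apply: polytime_tokens; do ![split; first exact: upoly_const].
move=> M i; exists (generator_circuit (l M) M i); split; last exact: generator_circuit_computes.
rewrite /on (tnth_nth [::]) /= size_nseq /generator_circuit.
case: leqP => h; last by [].
have [rM rl] := seed_le h.
have rp : (0 < root M)%N by apply: leq_trans h.
have np : (0 < root M ^ a)%N by rewrite expn_gt0 rp.
have [x0 x1 x2 x3] := index_lt rp np rM (ltn_ord i).
rewrite /circuit_code /share_circuit /=.
rewrite !gate_code_seed ?(leq_trans _ rl) //.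
rewrite /code1 /= !(tnth_nth [::]) /= !size_nseq.
by case: (share_on _ _ _); case: (prev_on _ _); case: (next_on _ _ _).
Qed.

Lemma VNC0_circuit_generator (F : fieldType) (i : nat -> nat) :
  VNC0 (coord_family (circuit_generator F l) i).
Proof.
have H M j : exists2 C : circuit F (l M),
    circuit_computes C (circuit_generator F l M)`_j /\ (circuit_size C <= 6)%N &
    (msize (circuit_generator F l M)`_j <= 8)%N.
  case: (ltnP j M) => jM; last first.
    rewrite nth_default ?size_tuple //.
    exists [:: GConst (l M) 0]; last by rewrite msize0.
    by do 2!split=> //; rewrite /circuit_eval /= mpolyC0.
  rewrite -(tnth_nth 0 (circuit_generator F l M) (Ordinal jM)).
  have cC := generator_circuit_computes F (Ordinal jM).
  eexists; first by split; [exact: cC|rewrite /generator_circuit; case: ifP => _ //;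
    rewrite share_circuit_size].
  rewrite tnth_circuit_generator /generator_circuit; case: ifP => _.
    exact: msize_share_coord.
  by rewrite /circuit_eval /= (ratr_nat F 0) mpolyC0 msize0.
split.
  exists 8 => M; have [_ _ h] := H M (i M).
  by apply: leq_trans (leq_pred _) _; apply: leq_trans h _; apply: leq_addl.
by exists 6 => M; have [C [cC sC] _] := H M (i M); exists C.
Qed.

End ExplicitGenerator.

Theorem theorem4p6 (R : realType) (F : fieldType) (charF0 : [pchar F] =i pred0)
    (eps : R) (eps_gt0 : 0 < eps)
    (det_hard : forall c : nat, exists N : nat, forall n : nat, (N <= n)%N ->
       forall phi : formula {fraction {poly F}} (n * n),
         border_formula phi (det_poly F n) -> (n ^ c <= formula_size phi)%N) :
  exists G : polymaps F (seed_length eps),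
    explicit G /\ hitting_set_generator (@VNC0 F) (@VF F) G.
Proof.
have [a a2 ea] := exists_root_exponent eps_gt0.
pose e := a.*2.+1; pose r0 := (2 ^ a.*2.-1 + 2)%N.
have r02 : (2 <= r0)%N by rewrite /r0 leq_addl.
have seed_le M : (r0 <= iroot e M)%N ->
    (iroot e M * (iroot e M ^ a) ^ 2 <= M)%N /\
    (seed_size (iroot e M) (iroot e M ^ a) M <= seed_length eps M)%N.
  move=> h; split; first by have [] := seed_size_root_bound a2 h.
  exact: seed_size_le_seed_length.
exists (circuit_generator a r0 F (seed_length eps)).
have r00 : (0 < r0)%N by apply: ltnW.
split; first exact: explicit_circuit_generator.
split; first by move=> i _; apply: VNC0_circuit_generator.
move=> f [_ [s [[c1 sc1] hs]]] [c2 nc2].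
(* At [k = r + 1] the number of variables is at most [k ^ e], hence the index is at most
   [(k ^ e) ^ c2 + c2]; [W] then bounds the reduced formula size, the matrix dimension and the
   constant 8. *)
pose W k := (2 * (((k ^ e) ^ c2 + c2) ^ c1 + c1) + 1 + k ^ e + 8)%N.
have [C WC] : pow_bounded W.
  apply: pow_bounded_add (pow_bounded_const 8); apply: pow_bounded_add; last first.
    exact: pow_bounded_exp pow_bounded_id.
  apply: pow_bounded_add (pow_bounded_const 1).
  have h : pow_bounded (fun k => ((k ^ e) ^ c2 + c2) ^ c1 + c1)%N.
    apply: pow_bounded_add (pow_bounded_const _); apply: pow_bounded_exp.
    apply: pow_bounded_add (pow_bounded_const _); do 2!apply: pow_bounded_exp.
    exact: pow_bounded_id.
  have [d hd] := pow_bounded_add h h; exists d => k k2.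
  by rewrite mul2n -addnn; apply: hd.
(* The upper bound will be [W ^ 23 <= (r + 1) ^ (23 C)]; one more in the exponent gives the
   contradiction. *)
have [Nh hard] := det_hard (23 * C + 1)%N.
pose B := maxn r0 Nh.
have leX x y d : (x <= y)%N -> (x ^ d <= y ^ d)%N.
  by move=> xy; case: d => // d; rewrite leq_exp2r.
(* If the root [r] were at most [B], the number of variables would be at most [(B + 1) ^ e] and the
   index below this value. *)
exists (((B.+1 ^ e) ^ c2 + c2).+1)%N => n nN.
split=> [fG0|->]; last exact: comp_mpoly0.
apply/eqP/negP => /negP f0.
pose M := nvars f n; pose r := iroot e M.
have Mr : (M <= r.+1 ^ e)%N by apply: ltnW; apply: iroot_lt_exp.
have rB : (B < r)%N.
  rewrite ltnNge; apply/negP => rB; move: nN; apply/negP; rewrite -leqNgt.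
  apply: leq_trans (nc2 n) _; rewrite leq_add2r; apply: (leX); rewrite -/M.
  by apply: leq_trans Mr _; apply: (leX).
have r0r : (r0 <= r)%N by apply: leq_trans (ltnW rB); apply: leq_maxl.
have Nr : (Nh <= r.+1)%N by apply: leqW; apply: leq_trans (ltnW rB); apply: leq_maxr.
have [rM rl] := seed_le M r0r; rewrite -/r in rM rl.
have r2 : (2 <= r)%N by apply: leq_trans r0r.
have r_gt0 : (0 < r)%N by apply: ltnW.
have [n' En] : exists n', (r ^ a)%N = n'.+1.
  by exists (r ^ a).-1; rewrite prednK // expn_gt0 r_gt0.
have [phi [phif phis]] := hs n.
have GE (i : 'I_M) : tnth (circuit_generator a r0 F (seed_length eps) M) i =
    share_coord F r n'.+1 (seed_length eps M) i.
  by rewrite tnth_circuit_generator /generator_circuit r0r -/r En.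
rewrite En in rM rl.
have [f' [phi' [phi'f phi's f'0 f'rank]]] :=
  share_generator_reduction charF0 r_gt0 rM rl GE f0 fG0 phif.
pose Q := (((r.+1 ^ e) ^ c2 + c2) ^ c1 + c1)%N.
have phiQ : (formula_size phi <= Q)%N.
  apply: leq_trans phis _; apply: leq_trans (sc1 n) _; rewrite leq_add2r; apply: (leX).
  by apply: leq_trans (nc2 n) _; rewrite leq_add2r; apply: (leX).
have WE : W r.+1 = (2 * Q + 1 + r.+1 ^ e + 8)%N by [].
have phi'W : (formula_size phi' <= W r.+1)%N.
  by apply: leq_trans phi's _; rewrite WE; move: phiQ; move: (formula_size phi) => u; lia.
have nW : (n'.+1 <= W r.+1)%N.
  have nM : (n'.+1 <= M)%N.
    apply: leq_trans rM; rewrite -mulnn mulnA.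
    by apply: leq_pmull; rewrite muln_gt0 r_gt0.
  by rewrite WE; lia.
have W8 : (8 <= W r.+1)%N by rewrite WE leq_addl.
have rn : (r < n'.+1)%N.
  by rewrite -En -{1}[r]expn1 ltn_exp2l.
have /border_le_formula[psi psib psiS] :=
  border_le_det charF0 rn f'0 phi'f f'rank nW phi'W W8.
have := leq_trans (hard _ Nr psi psib) psiS.
apply/negP; rewrite -ltnNge.
apply: leq_ltn_trans (leX _ _ 23 (WC r.+1 (ltnW _))) _ => //.
by rewrite -expnM mulnC ltn_exp2l ?addn1 // ltnW.
Qed.
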